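(* Under the explicit-state encoding, the problem STOCHASTIC-SUFFICIENCY-CHECK (given a stochastic decision problem $\mathcal{D}_S=(A,X_1,\ldots,X_n,U,P)$ and a coordinate set $I\subseteq\{1,\ldots,n\}$, decide whether $I$ is stochastically sufficient) is decidable in polynomial time.
   Context: A stochastic decision problem is a tuple $\mathcal{D}_S=(A,X_1,\ldots,X_n,U,P)$ with $A$ a finite set of actions, $X_1,\ldots,X_n$ finite sets, state space $S=X_1\times\cdots\times X_n$, utility $U:A\times S\to\mathbb{Q}$, and $P$ a probability distribution on $S$. For $I\subseteq\{1,\ldots,n\}$ and $s\in S$, $s_I$ denotes the restriction of $s$ to the coordinates in $I$. Let $\mathrm{Opt}(s)=\arg\max_{a\in A}U(a,s)$. For a value $\alpha$ of the coordinates in $I$, let $\mathrm{Opt}^{\mathrm{stoch}}_I(\alpha)=\arg\max_{a\in A}\sum_{s:\,s_I=\alpha}P(s)U(a,s)$; when the fiber $\{s: s_I=\alpha\}$ has positive probability this is $\arg\max_{a}\mathbb{E}[U(a,S)\mid S_I=\alpha]$ for $S\sim P$. $I$ is stochastically sufficient if $\mathrm{Opt}^{\mathrm{stoch}}_I(s_I)=\mathrm{Opt}(s)$ for every $s\in S$. In the explicit-state encoding the input lists every state of $S$ together with the full table of values $U(a,s)$ for all $a\in A$, $s\in S$, and the probabilities $P(s)$ for all $s\in S$ (as rationals), so input size is polynomial in $|S|\cdot|A|$ (and bit-lengths). *)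

(* Defs.v *)
From HB Require Import structures.
From mathcomp Require Import all_boot all_order all_algebra.

Set Implicit Arguments.
Unset Strict Implicit.
Unset Printing Implicit Defensive.

Import Order.TTheory GRing.Theory Num.Theory.

Inductive move := MoveLeft | Stay | MoveRight.

(* A deterministic Turing machine with ntapes.+1 tapes, tape 0 carrying the
   input, over the input alphabet Sigma. The tape alphabet
   is option (Sigma + work): None is the blank, inl the input symbols, inr
   further symbols. States are mapped by verdict to Some true (accepting),
   Some false (rejecting) or None (not halted). All components being finite,
   transition is a finite table. *)
Record machine (Sigma : finType) := Machine {
  ntapes : nat;
  work : finType;
  state : finType;
  start : state;
  verdict : state -> option bool;
  transition : state -> {ffun 'I_ntapes.+1 -> option (Sigma + work)} ->
    state * {ffun 'I_ntapes.+1 -> option (Sigma + work) * move}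
}.

(* A two-way infinite tape: the scanned cell, the cells on its left (nearest
   first) and on its right; every cell not represented is blank. *)
Record tape (G : Type) := Tape {
  tleft : seq (option G); scanned : option G; tright : seq (option G) }.

Definition write_move G (t : tape G) (a : option G * move) : tape G :=
  let: Tape l _ r := t in
  match a.2 with
  | MoveLeft => Tape (behead l) (head None l) (a.1 :: r)
  | Stay => Tape l a.1 r
  | MoveRight => Tape (a.1 :: l) (head None r) (behead r)
  end.

Section Runs.
Variables (Sigma : finType) (M : machine Sigma).

Definition symb : Type := (Sigma + work M)%type.

Definition config : Type :=
  (state M * {ffun 'I_(ntapes M).+1 -> tape symb})%type.

Definition input_tape (w : seq Sigma) : tape symb :=
  let cells := [seq Some (inl x) | x <- w] in
  Tape [::] (head None cells) (behead cells).

Definition initial (w : seq Sigma) : config :=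
  (start M, [ffun i => if i == ord0 then input_tape w
                       else Tape [::] None [::]]).

Definition step (c : config) : config :=
  if verdict c.1 is Some _ then c else
  let: (q, acts) := transition c.1 [ffun i => scanned (c.2 i)] in
  (q, [ffun i => write_move (c.2 i) (acts i)]).

(* The verdict after at most t steps (halted configurations do not move). *)
Definition verdict_after (w : seq Sigma) (t : nat) : option bool :=
  verdict (iter t step (initial w)).1.

Definition accepts (w : seq Sigma) : Prop :=
  exists t, verdict_after w t = Some true.

(* On every input word, well formed or not, M halts within a number of steps
   polynomial in the length of the word. *)
Definition polynomial_time : Prop :=
  exists c k : nat, forall w : seq Sigma,
    verdict_after w (c * size w ^ k + c) <> None.

End Runs.

(* The problem with instances of type Inst, written as words by enc and with
   yes-instances yes, is decidable in polynomial time. *)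
Definition poly_time_decidable (Sigma : finType) (Inst : Type)
    (enc : Inst -> seq Sigma) (yes : Inst -> Prop) : Prop :=
  exists M : machine Sigma,
    polynomial_time M /\ (forall x : Inst, accepts M (enc x) <-> yes x).

Local Open Scope ring_scope.

(* The coordinates 1, ..., n are the elements of 'I_n. *)
Record stoch_problem := StochProblem {
  ncoord : nat;
  action : finType;
  component : 'I_ncoord -> finType;
  utility : action -> {dffun forall i, component i} -> rat;
  prob : {dffun forall i, component i} -> rat;
  prob_ge0 : forall s, 0 <= prob s;
  prob_sum1 : \sum_s prob s = 1
}.

Definition argmax (A : finType) (f : A -> rat) : {set A} :=
  [set a | [forall b, f b <= f a]].

Section Sufficiency.
Variable D : stoch_problem.

Definition states : finType := {dffun forall i : 'I_(ncoord D), component i}.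

Definition partial_states (J : {set 'I_(ncoord D)}) : finType :=
  {dffun forall i : {i | i \in J}, component (val i)}.

Definition restriction (J : {set 'I_(ncoord D)}) (s : states) :
    partial_states J :=
  [ffun i : {i | i \in J} => s (val i)].

Definition opt (s : states) : {set action D} :=
  argmax (fun a => utility a s).

Definition opt_stoch (J : {set 'I_(ncoord D)}) (alpha : partial_states J) :
    {set action D} :=
  argmax (fun a => \sum_(s : states | restriction J s == alpha)
                     prob s * utility a s).

Definition stoch_sufficient (J : {set 'I_(ncoord D)}) : Prop :=
  forall s : states, opt_stoch (restriction J s) = opt s.

End Sufficiency.

Inductive symbol := Bit of bool | Minus | Slash | Comma | Bar | Semicolon.

Definition symbol_code (x : symbol) : bool * bool * bool :=
  match x with
  | Bit b => (false, false, b)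
  | Minus => (false, true, false)
  | Slash => (false, true, true)
  | Comma => (true, false, false)
  | Bar => (true, false, true)
  | Semicolon => (true, true, false)
  end.

Definition symbol_decode (x : bool * bool * bool) : symbol :=
  match x with
  | (false, false, b) => Bit b
  | (false, true, false) => Minus
  | (false, true, true) => Slash
  | (true, false, false) => Comma
  | (true, false, true) => Bar
  | (true, true, _) => Semicolon
  end.

Lemma symbol_codeK : cancel symbol_code symbol_decode.
Proof. by case=> [[]|||||]. Qed.

HB.instance Definition _ := Finite.copy symbol (can_type symbol_codeK).

(* Binary digits, least significant first, without leading zeros: up_log 2 n.+1
   is the least e such that n < 2 ^ e. *)
Definition enc_nat (n : nat) : seq symbol :=
  mkseq (fun i => Bit (odd (n %/ 2 ^ i)%N)) (up_log 2 n.+1).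

(* Signed numerator and denominator of the reduced fraction. *)
Definition enc_rat (q : rat) : seq symbol :=
  (if q < 0 then [:: Minus] else [::]) ++
  enc_nat `|numq q|%N ++ Slash :: enc_nat `|denq q|%N.

(* One entry of the table: the coordinates of s (each as the rank of its value
   in the corresponding finite set), P(s), and U(a, s) for all actions a. *)
Definition enc_state (D : stoch_problem) (s : states D) : seq symbol :=
  flatten [seq rcons (enc_nat (enum_rank (s i))) Comma
             | i <- enum 'I_(ncoord D)] ++
  Bar :: rcons (enc_rat (prob s)) Comma ++
  rcons (flatten [seq rcons (enc_rat (utility a s)) Comma
                    | a <- enum (action D)]) Semicolon.

Record check_instance := CheckInstance {
  problem : stoch_problem;
  coords : {set 'I_(ncoord problem)}
}.

(* The characteristic word of the coordinate set, then all the states. *)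
Definition explicit_encoding (x : check_instance) : seq symbol :=
  rcons [seq Bit (i \in coords x) | i <- enum 'I_(ncoord (problem x))]
        Semicolon ++
  flatten [seq enc_state s | s <- enum (states (problem x))].

(* Main.v *)
Require Import Defs.
From HB Require Import structures.
From mathcomp Require Import all_boot all_order all_algebra.
From mathcomp Require Import zify ring.
From Stdlib Require Import FunctionalExtensionality.

(** The decision procedure groups the listed states by their coordinates in [I]
    and, for every state, compares two vectors of booleans over the actions: the
    maximisers of the sum of [P U] over its fiber, and those of its own utility
    row. Fractions are triples [(p, n, d)] of naturals standing for
    [(p - n) / d], so that sums, products and comparisons need no subtraction,
    and the fiber sums are accumulated without reduction: their bit lengths stay
    bounded by the sum of the bit lengths of the terms.

    That it runs in polynomial time on a Turing machine is obtained
    compositionally. All data are coded as binary trees, written in Polish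
    notation on stacks; a function between such data is polynomial-time when a
    structured program on finitely many stacks computes it, and these functions
    are closed under pairing, projections, branching and iteration along a list,
    provided that the accumulator stays of polynomial size. A program on stacks
    is a Turing machine with one tape per stack, the program points being the
    states. *)

Set Implicit Arguments.
Unset Strict Implicit.
Unset Printing Implicit Defensive.

(** * Stack programs and their compilation *)

Section StackPrograms.
Variable Sigma : finType.

Local Notation letter := (Sigma + bool)%type.

Inductive cmd :=
| Push of nat & letter
| Pop of nat
| Seq of cmd & cmd
| Case of nat & (option letter -> cmd)
| While of nat & cmd.

Definition stacks := nat -> seq letter.

Definition upd (s : stacks) r v : stacks := fun i => if i == r then v else s i.

(* The step counts are those of the Turing machine [stack_machine] below. *)
Inductive exec : cmd -> stacks -> nat -> stacks -> Prop :=
| exec_push r a s : exec (Push r a) s 2 (upd s r (a :: s r))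
| exec_pop r s : exec (Pop r) s 1 (upd s r (behead (s r)))
| exec_seq p q s1 s2 s3 t u :
    exec p s1 t s2 -> exec q s2 u s3 -> exec (Seq p q) s1 (t + u) s3
| exec_case r f s t s' :
    exec (f (ohead (s r))) s t s' -> exec (Case r f) s t.+1 s'
| exec_while0 r p s : s r = [::] -> exec (While r p) s 1 s
| exec_whileS r p s1 s2 s3 t u :
    s1 r <> [::] -> exec p s1 t s2 -> exec (While r p) s2 u s3 ->
    exec (While r p) s1 (t + u).+1 s3.

(** Only [Push] lengthens a stack, by one letter in two steps. A time bound thereby becomes a bound
    on the size of the output. *)
Lemma exec_size p s t s' r : exec p s t s' -> size (s' r) <= size (s r) + t.
Proof.
elim=> {p s t s'} /=; try (move=> *; lia).
- by move=> r' a s; rewrite /upd; case: eqP => [->|_] /=; lia.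
- by move=> r' s; rewrite /upd; case: eqP => [->|_]; rewrite ?size_behead; lia.
Qed.

(** Program points serve as control states. [Push] has two, because the head must move left before
    it writes; [Case] and [While] add a point [None] at which the tested stack is read. *)
Fixpoint pos (p : cmd) : finType :=
  match p with
  | Push _ _ => bool
  | Pop _ => unit
  | Seq p q => (pos p + pos q)%type
  | Case _ f => option {a : option letter & pos (f a)}
  | While _ p => option (pos p)
  end.

Fixpoint entry p : pos p :=
  match p with
  | Push _ _ => false
  | Pop _ => tt
  | Seq p q => inl (entry p)
  | Case _ _ => None
  | While _ _ => None
  end.

Fixpoint reg p : pos p -> nat :=
  match p with
  | Push r _ => fun=> r
  | Pop r => fun=> r
  | Seq p q => fun x => match x with inl y => reg y | inr y => reg y end
  | Case r f => fun x => if x is Some y then reg (tagged y) else r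
  | While r p => fun x => if x is Some y then reg y else r
  end.

(* The next program point ([None] when the program is left), and the action on
   the tape [reg x], whose scanned symbol is the last argument. *)
Fixpoint next p :
    pos p -> option letter -> option (pos p) * (option letter * move) :=
  match p with
  | Push _ a => fun x h =>
      if x then (None, (Some a, Stay)) else (Some true, (h, MoveLeft))
  | Pop _ => fun _ h => (None, (None, if h is Some _ then MoveRight else Stay))
  | Seq p q => fun x h =>
      match x with
      | inl y => let: (o, act) := next y h in
          (Some (if o is Some z then inl z else inr (entry q)), act)
      | inr y => let: (o, act) := next y h in (omap inr o, act)
      end
  | Case _ f => fun x h =>
      if x is Some y then
        let: (o, act) := next (tagged y) h in
        (omap (fun z => Some (Tagged (fun a => pos (f a)) z)) o, act)
      else (Some (Some (Tagged (fun a => pos (f a)) (entry (f h)))), (h, Stay))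
  | While _ p => fun x h =>
      if x is Some y then let: (o, act) := next y h in (Some o, act)
      else (if h is Some _ then Some (Some (entry p)) else None, (h, Stay))
  end.

Definition tapes := nat -> tape letter.

Definition act_on (T : tapes) r (act : option letter * move) : tapes :=
  fun i => if i == r then write_move (T i) act else T i.

Inductive run p : pos p -> tapes -> nat -> tapes -> Prop :=
| run_exit x T act :
    next x (scanned (T (reg x))) = (None, act) ->
    run x T 1 (act_on T (reg x) act)
| run_next x y T act t T' :
    next x (scanned (T (reg x))) = (Some y, act) ->
    run y (act_on T (reg x) act) t T' -> run x T t.+1 T'.

Lemma run_seq_r p q (y : pos q) T t T' :
  run y T t T' -> @run (Seq p q) (inr y) T t T'.
Proof.
elim=> {y T t T'} [x T act e|x y T act t T' e _ IH].
  by apply: (@run_exit (Seq p q) (inr x)); rewrite /= e.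
by apply: (@run_next (Seq p q) (inr x) (inr y) _ act); rewrite /= ?e.
Qed.

(** The step that leaves [p] already lands on the entry of [q], so the times add up exactly. *)
Lemma run_seq_l p q (x : pos p) T t T' u T'' :
  run x T t T' -> run (entry q) T' u T'' ->
  @run (Seq p q) (inl x) T (t + u) T''.
Proof.
move=> rx rq; elim: rx rq => {x T t T'} [x T act e|x y T act t T' e _ IH] rq.
  apply: (@run_next (Seq p q) (inl x) (inr (entry q)) _ act); rewrite /= ?e //.
  exact: run_seq_r.
apply: (@run_next (Seq p q) (inl x) (inl y) _ act); rewrite /= ?e //.
exact: IH.
Qed.

Lemma run_case r f a (x : pos (f a)) T t T' :
  run x T t T' ->
  @run (Case r f) (Some (Tagged (fun a => pos (f a)) x)) T t T'.
Proof.
elim=> {x T t T'} [x T act e|x y T act t T' e _ IH].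
  have := @run_exit (Case r f) (Some (Tagged (fun a => pos (f a)) x)) T act.
  by apply; rewrite /= e.
apply: (@run_next (Case r f) (Some (Tagged (fun a => pos (f a)) x))
          (Some (Tagged (fun a => pos (f a)) y)) _ act); last exact: IH.
by rewrite /= e.
Qed.

(** Leaving the body yields [Some None], which is the test point of the loop. *)
Lemma run_while r p (x : pos p) T t T' u T'' :
  run x T t T' -> @run (While r p) None T' u T'' ->
  @run (While r p) (Some x) T (t + u) T''.
Proof.
move=> rx rq; elim: rx rq => {x T t T'} [x T act e|x y T act t T' e _ IH] rq.
  by apply: (@run_next (While r p) (Some x) None _ act); rewrite /= ?e.
apply: (@run_next (While r p) (Some x) (Some y) _ act); rewrite /= ?e //.
exact: IH.
Qed.

(* The stack has its top under the head; what is left of the head is junk. *)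
Definition holds (tp : tape letter) (v : seq letter) :=
  exists j, scanned tp :: tright tp = [seq Some a | a <- v] ++ nseq j None.

Lemma holds_scanned tp v : holds tp v -> scanned tp = ohead v.
Proof. by case=> j; case: v => [|a v] /=; case: j => [|j] //= -[]. Qed.

Lemma holds_push tp v a : holds tp v ->
  holds (write_move (write_move tp (scanned tp, MoveLeft)) (Some a, Stay))
        (a :: v).
Proof. by case: tp => l h r [j /= e]; exists j; rewrite /= e. Qed.

Lemma holds_pop tp v : holds tp v ->
  holds (write_move tp (None, if scanned tp is Some _ then MoveRight else Stay))
        (behead v).
Proof.
move=> hv; rewrite (holds_scanned hv); case: tp hv => l h r [j /=].
case: v => [|a v] /=; first by case: j => [|j] //= -[_ ->]; exists j.+1.
case=> _ ->; case: v => [|b v] /=; last by exists j.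
by case: j => [|j] /=; [exists 1|exists j.+1].
Qed.

(** Test points write back the scanned symbol in place, hence leave the tapes as they are. *)
Lemma act_stay (T : tapes) r : act_on T r (scanned (T r), Stay) = T.
Proof.
apply: functional_extensionality => i; rewrite /act_on.
by case: eqP => // ->; case: (T r).
Qed.

(** An exact simulation, by induction on the derivation: each constructor of [exec] is matched by a
    run of the same number of steps. *)
Lemma exec_run p s t s' (T : tapes) :
  exec p s t s' -> (forall i, holds (T i) (s i)) ->
  exists2 T', run (entry p) T t T' & forall i, holds (T' i) (s' i).
Proof.
move=> ex; elim: ex T => {p s t s'}.
- move=> r a s T hT; pose T1 := act_on T r (scanned (T r), MoveLeft).
  exists (act_on T1 r (Some a, Stay)).
    apply: (@run_next (Push r a) _ true) => //.
    exact: (@run_exit (Push r a)).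
  move=> i; rewrite /T1 /act_on /upd; case: eqP => // ->; exact: holds_push.
- move=> r s T hT.
  exists (act_on T r
           (None, if scanned (T r) is Some _ then MoveRight else Stay)).
    exact: (@run_exit (Pop r)).
  by move=> i; rewrite /act_on /upd; case: eqP => // ->; apply: holds_pop.
- move=> p q s1 s2 s3 t u _ IHp _ IHq T /IHp[T' rp /IHq[T'' rq hT]].
  by exists T'' => //; apply: run_seq_l rp rq.
- move=> r f s t s' _ IH T hT; have [T' rf hT'] := IH _ hT; exists T' => //.
  apply: run_next; first reflexivity.
  by rewrite /= act_stay (holds_scanned (hT r)); apply: run_case rf.
- move=> r p s e T hT; exists T => //.
  rewrite -[X in run _ _ _ X](act_stay T r); apply: (@run_exit (While r p)).
  by rewrite /= (holds_scanned (hT r)) e.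
- move=> r p s1 s2 s3 t u ne _ IHp _ IHw T hT.
  have [T' rp /IHw[T'' rw hT'']] := IHp _ hT; exists T'' => //.
  apply: (@run_next (While r p) _ (Some (entry p)) _ (scanned (T r), Stay)).
    by rewrite /= (holds_scanned (hT r)); case: (s1 r) ne.
  by rewrite /= act_stay; apply: run_while rp rw.
Qed.

(** * The Turing machine of a program *)

Section Compile.
Variable p : cmd.

Definition max_reg := \max_(x : pos p) reg x.

(** [inl (Some x)] is a program point. [inl None] is reached on leaving the program and spends one
    step on reading the verdict from the top of stack 0. [inr b] has halted. *)
Definition stack_transition (q : option (pos p) + bool)
    (h : {ffun 'I_max_reg.+1 -> option letter}) :
    (option (pos p) + bool) *
    {ffun 'I_max_reg.+1 -> option letter * move} :=
  let still i := (h i, Stay) in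
  match q with
  | inl (Some x) =>
      let: (o, act) := next x (h (inord (reg x))) in
      (inl o, [ffun i : 'I_max_reg.+1 =>
                 if i == reg x :> nat then act else still i])
  | inl None => (inr (h ord0 == Some (inr true)), [ffun i => still i])
  | inr b => (q, [ffun i => still i])
  end.

Definition stack_machine : machine Sigma :=
  @Machine Sigma max_reg bool (option (pos p) + bool)%type
    (inl (Some (entry p)))
    (fun q => match q with inl _ => None | inr b => Some b end)
    stack_transition.

Lemma run_machine (x : pos p) T t T' (c : config stack_machine) :
  run x T t T' -> c.1 = inl (Some x) -> (forall i, c.2 i = T i) ->
  (iter t (@step _ stack_machine) c).1 = inl None /\
  (forall i, (iter t (@step _ stack_machine) c).2 i = T' i).
Proof.
move=> rx; elim: rx c => {x T t T'}.
- move=> x T act e [q c] /= -> hc.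
  (* [max_reg] bounds every tape index in use, so [inord] does not fall back on its default. *)
  have xK : (@inord max_reg (reg x) : nat) = reg x.
    by rewrite inordK // ltnS; apply: (@leq_bigmax _ (@reg p)).
  rewrite /step /= !ffunE hc xK e /=; split=> // i; rewrite !ffunE hc /act_on.
  by case: eqP => // _; case: (T i).
- move=> x y T act t T' e _ IH [q c] /= -> hc.
  have xK : (@inord max_reg (reg x) : nat) = reg x.
    by rewrite inordK // ltnS; apply: (@leq_bigmax _ (@reg p)).
  rewrite -iterS iterSr; apply: IH; rewrite /step /= !ffunE hc xK e //= => i.
  by rewrite !ffunE hc /act_on; case: eqP => // _; case: (T i).
Qed.

End Compile.

Definition input_store (w : seq Sigma) : stacks :=
  upd (fun=> [::]) 0 [seq inl a | a <- w].

Lemma exec_verdict p w t s' :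
  exec p (input_store w) t s' ->
  verdict_after (stack_machine p) w t.+1
    = Some (ohead (s' 0) == Some (inr true)).
Proof.
(* The initial tapes, extended by blank ones to all indices as [exec_run] requires. *)
pose T i : tape letter := if i == 0 then input_tape (stack_machine p) w
                          else Tape [::] None [::].
move=> /(exec_run (T := T))[i|T' /run_machine rT' hT'].
  rewrite /T /input_store /upd; case: eqP => _; last by exists 1.
  rewrite /input_tape; case: (w) => [|a u]; first by exists 1.
  by exists 0; rewrite /= cats0 -map_comp.
have [||e1 e2] := rT' (initial (stack_machine p) w).
- by [].
- by move=> i; rewrite ffunE /T -(inj_eq val_inj).
rewrite /verdict_after iterS; move: e1 (e2 ord0) (hT' 0).
case: (iter t _ _) => q c /= -> e0 h0.
by rewrite /step /= !ffunE e0 (holds_scanned h0).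
Qed.

End StackPrograms.

Arguments Pop {Sigma} _.

Lemma verdict_stable (Sigma : finType) (M : machine Sigma) w t u b :
  verdict_after M w t = Some b -> t <= u -> verdict_after M w u = Some b.
Proof.
move=> vt /subnK <-; elim: (u - t) => // n; rewrite addSn /verdict_after iterS.
by move: (iter _ _ _) => c e; rewrite /step e.
Qed.

Lemma leq_expl e m n : m <= n -> m ^ e <= n ^ e.
Proof. by case: e => // e; rewrite leq_exp2r. Qed.

Lemma stack_program_decides (Sigma : finType) (p : cmd Sigma)
    (d : seq Sigma -> bool) c :
  (forall w, exists t s', [/\ t <= (size w + 2) ^ c,
     exec p (input_store w) t s' & ohead (s' 0) = Some (inr (d w))]) ->
  exists M : machine Sigma,
    polynomial_time M /\ (forall w, accepts M w <-> d w).
Proof.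
move=> hp; exists (stack_machine p).
have hv w : exists2 t, t <= (size w + 2) ^ c &
    verdict_after (stack_machine p) w t.+1 = Some (d w).
  have [t [s' [le_t ex e]]] := hp w; exists t => //.
  by rewrite (exec_verdict ex) e; case: (d w).
split=> [|w].
(* With n the length of [w], use 2 ^ c <= 3 ^ c if n = 0 and n + 2 <= 3 * n otherwise. The successor
   pays for the step that reads the verdict. *)
- exists (3 ^ c).+1, c => w; have [t le_t /verdict_stable vt] := hv w.
  rewrite (vt _) // addnS ltnS; apply: leq_trans le_t _.
  case: (size w) => [|n].
    by apply: leq_trans (leq_addl _ _); apply: leq_expl.
  apply: leq_trans (leq_addr _ _).
  apply: leq_trans (leq_mul (leqnSn _) (leqnn _)).
  by rewrite -expnMn; apply: leq_expl; lia.
(* Verdicts reached at two times both persist to the later one, hence agree. *)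
- have [t _ vt] := hv w.
  split=> [[u vu]|dw]; last by exists t.+1; rewrite vt dw.
  have := verdict_stable vt (leq_maxl t.+1 u).
  by rewrite (verdict_stable vu (leq_maxr _ _)) => -[].
Qed.

(** * Polynomial bounds *)

(** As the base is at least 2, constant factors are absorbed by the exponent. *)
Definition pbound (A : Type) (sz T : A -> nat) :=
  exists c, forall a, T a <= (sz a + 2) ^ c.

Section PolynomialBounds.
Variables (A : Type) (sz : A -> nat).
Implicit Types T U : A -> nat.

Lemma leq_pbound T U : (forall a, T a <= U a) -> pbound sz U -> pbound sz T.
Proof. by move=> leTU [c hc]; exists c => a; apply: leq_trans (hc a). Qed.

Lemma pbound_const k : pbound sz (fun=> k).
Proof.
exists k => a; apply: leq_trans (leq_expl _ (leq_addl _ 2)).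
exact/ltnW/ltn_expl.
Qed.

Lemma pbound_id : pbound sz sz.
Proof. by exists 1 => a; rewrite expn1 leq_addr. Qed.

Lemma pboundD T U :
  pbound sz T -> pbound sz U -> pbound sz (fun a => T a + U a).
Proof.
move=> [c hc] [d hd]; exists (c + d).+1 => a; have := hc a; have := hd a.
rewrite expnS expnD; set x := _ ^ c; set y := _ ^ d => leU leT.
have x0 : 0 < x by rewrite expn_gt0 addn2.
have y0 : 0 < y by rewrite expn_gt0 addn2.
(* Both powers are positive, so their sum is at most twice their product; one more factor of the
   base covers the 2. *)
have : T a + U a <= 2 * (x * y) by nia.
by move/leq_trans; apply; rewrite leq_mul2r leq_addl orbT.
Qed.

Lemma pboundM T U :
  pbound sz T -> pbound sz U -> pbound sz (fun a => T a * U a).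
Proof.
by move=> [c hc] [d hd]; exists (c + d) => a; rewrite expnD leq_mul.
Qed.

Lemma pbound_trans T U : pbound sz U -> pbound U T -> pbound sz T.
Proof.
(* With x = (sz a + 2) ^ c one has U a + 2 <= x + 2 <= 4 * x <= (sz a + 2) ^ (c + 2). *)
move=> [c hc] [d hd]; exists (c.+2 * d) => a; apply: leq_trans (hd a) _.
rewrite expnM; apply: leq_expl; rewrite !expnS.
have := hc a; have : 0 < (sz a + 2) ^ c by rewrite expn_gt0 addn2.
by set x := _ ^ c => *; nia.
Qed.

End PolynomialBounds.

Lemma pbound_comp (A B : Type) (szA : A -> nat) (szB T : B -> nat)
    (h : A -> B) :
  pbound szB T -> pbound szA (fun a => szB (h a)) ->
  pbound szA (fun a => T (h a)).
Proof. by move=> [c hc] /pbound_trans; apply; exists c. Qed.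

(** * Binary trees on stacks *)

Inductive tree := Leaf | Node of tree & tree.

(** Polish notation is self-delimiting: a tree can be cut off the front of a longer word without
    separators. *)
Fixpoint code (t : tree) : seq bool :=
  if t is Node l r then true :: code l ++ code r else [:: false].

Definition tsize t := size (code t).

Local Notation prog := (cmd symbol).
Local Notation store := (stacks symbol).

Definition cells (t : tree) : seq (symbol + bool) := [seq inr b | b <- code t].

Lemma cells_Node l r : cells (Node l r) = inr true :: cells l ++ cells r.
Proof. by rewrite /cells /= map_cat. Qed.

Lemma size_cells t : size (cells t) = tsize t.
Proof. exact: size_map. Qed.

Definition exec_le (p : prog) s t s' := exists2 u, u <= t & exec p s u s'.

Lemma exec_le_seq p q s1 s2 s3 t u :
  exec_le p s1 t s2 -> exec_le q s2 u s3 -> exec_le (Seq p q) s1 (t + u) s3.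
Proof.
move=> [t' le_t ep] [u' le_u eq]; exists (t' + u'); first exact: leq_add.
exact: exec_seq ep eq.
Qed.

Lemma exec_le_push r a s : exec_le (Push r a) s 2 (upd s r (a :: s r)).
Proof. by exists 2 => //; constructor. Qed.

Lemma exec_le_pop r s : exec_le (Pop r) s 1 (upd s r (behead (s r))).
Proof. by exists 1 => //; constructor. Qed.

Lemma exec_le_case r f s t s' :
  exec_le (f (ohead (s r))) s t s' -> exec_le (Case r f) s t.+1 s'.
Proof. by case=> u le_u e; exists u.+1 => //; constructor. Qed.

Lemma exec_le_while0 r p s : s r = [::] -> exec_le (While r p) s 1 s.
Proof. by exists 1 => //; constructor. Qed.

Lemma exec_le_whileS r p s1 s2 s3 t u :
  s1 r <> [::] -> exec_le p s1 t s2 -> exec_le (While r p) s2 u s3 ->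
  exec_le (While r p) s1 (t + u).+1 s3.
Proof.
move=> ne [t' le_t ep] [u' le_u eq]; exists (t' + u').+1.
  by rewrite ltnS leq_add.
exact: exec_whileS ep eq.
Qed.

Lemma exec_le_weaken p s t s' t' s'' :
  exec_le p s t s' -> t <= t' -> s' =1 s'' -> exec_le p s t' s''.
Proof.
move=> [u le_u e] le_t /functional_extensionality <-.
by exists u => //; apply: leq_trans le_t.
Qed.

Ltac store_eq :=
  let i := fresh "i" in
  rewrite /upd => i /=; repeat (case: (eqVneq _ _) => [?|?]); subst => //=;
  try lia; try congruence.

Definition clear r : prog := While r (Pop r).

Lemma exec_clear r s : exec_le (clear r) s (2 * size (s r)).+1 (upd s r [::]).
Proof.
move e: (s r) => v; elim: v s e => [|a v IH] s e.
  by apply: (exec_le_weaken (exec_le_while0 _ e)) => //; store_eq.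
apply: (@exec_le_weaken _ _ (1 + (2 * size v).+1).+1).
- apply: exec_le_whileS (exec_le_pop _ _) (IH _ _); first by rewrite e.
  by rewrite /upd eqxx e.
- by rewrite /=; lia.
- store_eq.
Qed.

(** Moving a stack letter by letter reverses it, whence [catrev] below. *)
Definition transfer r1 r2 : prog :=
  While r1 (Case r1 (fun a =>
    if a is Some b then Seq (Pop r1) (Push r2 b) else Pop r1)).

Lemma exec_transfer r1 r2 s : r1 != r2 ->
  exec_le (transfer r1 r2) s (5 * size (s r1)).+1
    (upd (upd s r1 [::]) r2 (catrev (s r1) (s r2))).
Proof.
move=> ne; move e: (s r1) => v; elim: v s e => [|a v IH] s e.
  by apply: (exec_le_weaken (exec_le_while0 _ e)) => //=; store_eq.
apply: (@exec_le_weaken _ _ ((1 + 2).+1 + (5 * size v).+1).+1).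
- apply: exec_le_whileS; first by rewrite e.
    apply: exec_le_case; rewrite e /=.
    exact: exec_le_seq (exec_le_pop _ _) (exec_le_push _ _ _).
  by apply: IH; rewrite /upd (negPf ne) eqxx e.
- by rewrite /=; lia.
- store_eq.
Qed.

(** The detour through [tmp] reverses twice, so both copies have the original order. *)
Definition duplicate r tmp r' : prog :=
  Seq (transfer r tmp)
   (While tmp (Case tmp (fun a =>
      if a is Some b then Seq (Pop tmp) (Seq (Push r b) (Push r' b))
      else Pop tmp))).

Lemma exec_duplicate r tmp r' s :
  r != tmp -> r != r' -> tmp != r' -> s tmp = [::] -> s r' = [::] ->
  exec_le (duplicate r tmp r') s (12 * size (s r)).+2 (upd s r' (s r)).
Proof.
move=> ne1 ne2 ne3 e1 e2.
(* The second phase is generalised to arbitrary contents of [r] and [r'], for an induction on the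
   contents of [tmp]. *)
suff copy v : forall s, s tmp = v -> exec_le (While tmp (Case tmp (fun a =>
      if a is Some b then Seq (Pop tmp) (Seq (Push r b) (Push r' b))
      else Pop tmp))) s (7 * size v).+1
    (upd (upd (upd s tmp [::]) r (catrev v (s r))) r' (catrev v (s r'))).
  have cp := copy (rev (s r)).
  apply: (exec_le_weaken (exec_le_seq (exec_transfer _ ne1) (cp _ _))).
  - by rewrite /upd eqxx e1.
  - by rewrite size_rev; lia.
  - rewrite /upd !catrevE revK => i /=; rewrite (eq_sym r' r) (negPf ne2).
    rewrite (eq_sym r' tmp) (negPf ne3) e2 eqxx (negPf ne1) !cats0.
    by case: eqP => // _; case: eqP => [->//|_]; case: eqP => // ->.
elim: v => [|a v IH] {e1 e2} s' e.
  by apply: (exec_le_weaken (exec_le_while0 _ e)) => //=; store_eq.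
apply: (@exec_le_weaken _ _ ((1 + (2 + 2)).+1 + (7 * size v).+1).+1).
- apply: exec_le_whileS; first by rewrite e.
    apply: exec_le_case; rewrite e /=.
    apply: exec_le_seq (exec_le_pop _ _) _.
    exact: exec_le_seq (exec_le_push _ _ _) (exec_le_push _ _ _).
  by apply: IH; rewrite /upd eqxx (negPf ne3) eq_sym (negPf ne1) e.
- by rewrite /=; lia.
- store_eq.
Qed.

(** * Polynomial-time functions on encoded data *)

Class data (A : Type) := enc : A -> tree.
Arguments enc {A data} _.

Definition dsize {A : Type} {dA : data A} (a : A) := tsize (enc a).

(** Stacks 1 to K - 1 are scratch, empty before and after; those from [K] on are arbitrary and come
    back unchanged. Data can therefore be saved above [K] while [p] runs. *)
Definition maps (p : prog) K t x y :=
  forall s : store, s 0 = cells x -> (forall i, 0 < i < K -> s i = [::]) ->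
  exec_le p s t (upd s 0 (cells y)).

Lemma maps_weaken p K t x y K' t' :
  maps p K t x y -> K <= K' -> t <= t' -> maps p K' t' x y.
Proof.
move=> hp leK le_t s s0 sK; have [|u le_u e] := hp s s0.
  by move=> i /andP[i0 iK]; apply: sK; rewrite i0 (leq_trans iK).
by exists u => //; apply: leq_trans le_t.
Qed.

Lemma maps_seq p q K t u x y z :
  maps p K t x y -> maps q K u y z -> maps (Seq p q) K (t + u) x z.
Proof.
move=> hp hq s s0 sK; apply: exec_le_weaken.
- apply: exec_le_seq (hp s s0 sK) (hq _ _ _); first by rewrite /upd.
  by move=> i iK; rewrite /upd gtn_eqF ?sK //; case/andP: iK.
- by [].
- store_eq.
Qed.

Definition ptime {A B : Type} {dA : data A} {dB : data B} (f : A -> B) :=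
  exists p K T, pbound dsize T /\
    forall a, maps p K (T a) (enc a) (enc (f a)).

Section Combinators.
Context {A B C : Type} {dA : data A} {dB : data B} {dC : data C}.

(** By [exec_size], the output is no longer than the input plus the running time. *)
Lemma dsize_ptime (f : A -> B) : ptime f -> pbound dsize (fun a => dsize (f a)).
Proof.
move=> [p [K [T [bT hp]]]]; apply: leq_pbound (pboundD (pbound_id _) bT) => a.
have [] := hp a (upd (fun=> [::]) 0 (cells (enc a))) erefl.
  by case=> // i.
move=> u le_u /(exec_size 0); rewrite /upd /= !size_cells => le1.
by apply: leq_trans le1 _; rewrite leq_add2l.
Qed.

(** Complexity depends on the codes alone. This passes between a type and the one through which its
    code is defined, as for [nat] and [symbol]. *)
Lemma ptime_same_enc (f : A -> B) (g : A -> C) :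
  (forall a, enc (g a) = enc (f a)) -> ptime f -> ptime g.
Proof.
move=> e [p [K [T [bT hp]]]]; exists p, K, T; split=> // a.
by rewrite e; apply: hp.
Qed.

Lemma ptime_ext (f g : A -> B) : f =1 g -> ptime f -> ptime g.
Proof.
by move=> fg [p [K [T [bT hp]]]]; exists p, K, T; split=> // a; rewrite -fg.
Qed.

Lemma ptime_comp (g : B -> C) (f : A -> B) :
  ptime g -> ptime f -> ptime (fun a => g (f a)).
Proof.
move=> [q [Kq [Tq [bq hq]]]] pf; have bf := dsize_ptime pf.
have [p [Kp [Tp [bp hp]]]] := pf.
exists (Seq p q), (maxn Kp Kq), (fun a => Tp a + Tq (f a)); split.
  exact: pboundD bp (pbound_comp bq bf).
move=> a; apply: maps_seq.
  by apply: maps_weaken (hp a) _ _ => //; apply: leq_maxl.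
by apply: maps_weaken (hq _) _ _ => //; apply: leq_maxr.
Qed.

End Combinators.

Lemma ptime_id {A : Type} {dA : data A} : ptime (fun a : A => a).
Proof.
pose l : symbol + bool := inr true.
(* A push undone by a pop serves as the empty program. *)
exists (Seq (Push 0 l) (Pop 0)), 0, (fun=> 3).
split=> [|a s s0 _]; first exact: pbound_const.
apply: exec_le_weaken.
- exact: exec_le_seq (exec_le_push _ _ _) (exec_le_pop _ _).
- by [].
- by rewrite /upd /= => i; case: eqP => // ->.
Qed.

(** The last letter of [v] is pushed first, so that [v] reads in order from the top. *)
Definition push_after (p : prog) (v : seq (symbol + bool)) : prog :=
  foldr (fun a q => Seq q (Push 0 a)) p v.

Lemma exec_push_after p v s t s' :
  exec_le p s t s' ->
  exec_le (push_after p v) s (t + 2 * size v) (upd s' 0 (v ++ s' 0)).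
Proof.
move=> ep; elim: v => [|a v IH].
  by apply: (exec_le_weaken ep); [lia | store_eq].
apply: (exec_le_weaken (exec_le_seq IH (exec_le_push _ _ _))) => /=.
  by lia.
store_eq.
Qed.

Lemma ptime_const {A B : Type} {dA : data A} {dB : data B} (b : B) :
  ptime (fun _ : A => b).
Proof.
exists (push_after (clear 0) (cells (enc b))), 0,
  (fun a : A => (2 * dsize a).+1 + 2 * dsize b); split.
  apply: (@leq_pbound _ _ _ (fun a : A => 2 * dsize a + (1 + 2 * dsize b))).
    by move=> a; lia.
  apply: pboundD (pbound_const _ _); apply: pboundM (pbound_id _).
  exact: pbound_const.
move=> a s s0 _; rewrite /dsize -!size_cells -s0.
apply: exec_le_weaken (exec_push_after _ (exec_clear _ _)) (leqnn _) _.
by move=> i; rewrite /upd cats0; case: eqP.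
Qed.

(** * Pairing of results *)

Section Pairing.
Context {A B C : Type} {dA : data A} {dB : data B} {dC : data C}.

(* [q] runs first, on a copy, so that the code of its result ends up below. *)
Definition pair_prog r1 r2 r3 (p q : prog) : prog :=
  Seq (duplicate 0 r1 r2)
 (Seq q
 (Seq (transfer 0 r1)
 (Seq (transfer r2 r3)
 (Seq (transfer r3 0)
 (Seq p
 (Seq (transfer 0 r2)
 (Seq (transfer r1 0)
 (Seq (transfer r2 0) (Push 0 (inr true)))))))))).

(** Stated for trees, because pairs and nonempty lists are both coded by [Node]. *)
Lemma ptime_node (f : A -> B) (g : A -> C) :
  ptime f -> ptime g ->
  exists p K T, pbound dsize T /\
    forall a, maps p K (T a) (enc a) (Node (enc (f a)) (enc (g a))).
Proof.
move=> pf pg; have bf := dsize_ptime pf; have bg := dsize_ptime pg.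
have [p [Kp [Tp [bp hp]]]] := pf; have [q [Kq [Tq [bq hq]]]] := pg.
set K := maxn Kp Kq; exists (pair_prog K.+1 K.+2 K.+3 p q), K.+4.
exists (fun a => (22 * dsize a + 11 * dsize (f a)) +
                 (10 * dsize (g a) + (Tp a + (Tq a + 12)))); split.
  have bM k (T : A -> nat) : pbound dsize T -> pbound dsize (fun a => k * T a).
    exact/pboundM/pbound_const.
  by do ! [apply: pboundD | apply: bM | apply: pbound_const | apply: pbound_id].
move=> a s s0 sK.
(* The registers become variables whose comparisons are collected in [E], so that [upd] is evaluated
   by rewriting. *)
move e3: (K.+3) => r3; move e2: (K.+2) => r2; move e1: (K.+1) => r1.
have s1 : s r1 = [::] by apply: sK; lia.
have s2 : s r2 = [::] by apply: sK; lia.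
have s3 : s r3 = [::] by apply: sK; lia.
have hp' := maps_weaken (hp a) (leq_maxl Kp Kq) (leqnn _).
have hq' := maps_weaken (hq a) (leq_maxr Kp Kq) (leqnn _).
have [lt1 lt2 lt3] : [/\ K < r1, K < r2 & K < r3] by split; lia.
have [n12 n13 n23] :
  [/\ r1 == r2 = false, r1 == r3 = false & r2 == r3 = false] by split; lia.
have ne r : K < r -> (0 == r = false) * (r == 0 = false) by split; lia.
have ltr i r : i < K -> K < r -> i == r = false by lia.
pose E := (eqxx, n12, n13, n23, eq_sym r2 r1, eq_sym r3 r1, eq_sym r3 r2,
           ne _ lt1, ne _ lt2, ne _ lt3).
apply: exec_le_weaken.
- apply: exec_le_seq; first by apply: exec_duplicate; rewrite ?E.
  apply: exec_le_seq.
    apply: hq'; first by rewrite /upd !E.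
    by move=> i /andP[i0 iK]; rewrite /upd ltr // sK //; lia.
  apply: exec_le_seq; first by apply: exec_transfer; rewrite !E.
  apply: exec_le_seq; first by apply: exec_transfer; rewrite !E.
  apply: exec_le_seq; first by apply: exec_transfer; rewrite !E.
  apply: exec_le_seq.
    apply: hp'.
      by rewrite /upd !E s0 s3 !catrevE !cats0 revK.
    by move=> i /andP[i0 iK]; rewrite /upd (gtn_eqF i0) !ltr // sK //; lia.
  apply: exec_le_seq; first by apply: exec_transfer; rewrite !E.
  apply: exec_le_seq; first by apply: exec_transfer; rewrite !E.
  apply: exec_le_seq; first by apply: exec_transfer; rewrite !E.
  exact: exec_le_push.
- rewrite /upd !E s0 s1 s3 !catrevE !cats0 !size_rev !size_cells /dsize.
  by lia.
- move=> i; rewrite cells_Node /upd !E s0 s1 s3 !catrevE !cats0 !revK.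
  case: eqP => //= _; case: eqP => [->|_]; first by rewrite s2.
  case: eqP => [->|_]; first by rewrite s1.
  by case: eqP => [->|_].
Qed.

End Pairing.

(* Moves codes of trees from stack 0 to stack 2, reversed; stack 1 counts in
   unary how many complete trees remain to be read. *)
Definition scan : prog :=
  While 1 (Case 0 (fun a =>
    if a is Some (inr true) then
      Seq (Pop 0) (Seq (Push 2 (inr true)) (Push 1 (inr true)))
    else Seq (Pop 0) (Seq (Push 2 (inr false)) (Pop 1)))).

(** In continuation form: the scan that remains after [x] is a hypothesis, so that the two subtrees
    of a node can be chained. *)
Lemma exec_scan x (s : store) a n rest t s' :
  s 0 = cells x ++ rest -> s 1 = a :: n ->
  exec_le scan
    (upd (upd (upd s 0 rest) 1 n) 2 (catrev (cells x) (s 2))) t s' ->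
  exec_le scan s (7 * tsize x + t) s'.
Proof.
elim: x s a n rest t => [|l IHl r IHr] s a n rest t s0 s1 ex.
  apply: (@exec_le_weaken _ _ ((1 + (2 + 1)).+1 + t).+1) => //.
  apply: exec_le_whileS; first by rewrite s1.
    apply: exec_le_case; rewrite s0 /=.
    apply: exec_le_seq (exec_le_pop _ _) _.
    exact: exec_le_seq (exec_le_push _ _ _) (exec_le_pop _ _).
  congr (exec_le scan _ t s'): ex; apply: functional_extensionality.
  move=> i; rewrite /upd s0 s1 /=. by case: i => [|[|[|i]]].
apply: (@exec_le_weaken _ _ ((1 + (2 + 2)).+1 +
         (7 * tsize l + (7 * tsize r + t))).+1) => //; last first.
  by rewrite /tsize /= size_cat; lia.
apply: exec_le_whileS; first by rewrite s1.
  apply: exec_le_case; rewrite s0 /=.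
  apply: exec_le_seq (exec_le_pop _ _) _.
  exact: exec_le_seq (exec_le_push _ _ _) (exec_le_push _ _ _).
(* A node replaces one awaited tree by two: the pushed letter stands for the left subtree, [a] for
   the right one. *)
apply: (IHl _ (inr true) (a :: n) (cells r ++ rest)).
- by rewrite /upd /= s0 cells_Node /= catA.
- by rewrite /upd /= s1.
apply: (IHr _ a n rest) => //.
congr (exec_le scan _ t s'): ex; apply: functional_extensionality.
move=> i; rewrite cells_Node /upd /=.
case: i => [|[|[|i]]] //=.
by rewrite !catrevE rev_cat -!catA.
Qed.

(** Started with counter one, the scan stops exactly at the boundary between the two subtrees. *)
Lemma exec_split x y (s : store) :
  s 0 = cells (Node x y) -> s 1 = [::] -> s 2 = [::] ->
  exec_le (Seq (Pop 0) (Seq (Push 1 (inr true)) scan)) s (7 * tsize x + 4)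
    (upd (upd s 0 (cells y)) 2 (rev (cells x))).
Proof.
move=> s0 s1 s2.
apply: (@exec_le_weaken _ _ (1 + (2 + (7 * tsize x + 1)))).
- apply: exec_le_seq (exec_le_pop _ _) _.
  apply: exec_le_seq (exec_le_push _ _ _) _.
  apply: (exec_scan (x := x) (a := inr true) (n := [::]) (rest := cells y)).
  + by rewrite /upd /= s0 cells_Node.
  + by rewrite /upd /= s1.
  by apply: exec_le_while0; rewrite /upd.
- by lia.
- by case=> [|[|[|i]]]; rewrite /upd //= s2 catrevE cats0.
Qed.

(* Both codes have the same size, so that the size of a binary number is a
   function of its length. *)
#[export] Instance bool_data : data bool := fun b =>
  if b then Node (Node Leaf Leaf) Leaf else Node Leaf (Node Leaf Leaf).

#[export] Instance prod_data {A B : Type} {dA : data A} {dB : data B} :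
  data (A * B) := fun p => Node (enc p.1) (enc p.2).

#[export] Instance seq_data {A : Type} {dA : data A} : data (seq A) :=
  foldr (fun a t => Node (enc a) t) Leaf.

Lemma ptime_fst_proj {A B : Type} {dA : data A} {dB : data B} :
  ptime (fun p : A * B => p.1).
Proof.
exists (Seq (Seq (Pop 0) (Seq (Push 1 (inr true)) scan))
         (Seq (clear 0) (transfer 2 0))), 3, (fun p => 14 * dsize p + 6).
split.
  apply: pboundD (pbound_const _ _); apply: pboundM (pbound_id _).
  exact: pbound_const.
move=> [a b] s /= s0 sK; apply: exec_le_weaken.
- apply: exec_le_seq; first by apply: exec_split s0 _ _; apply: sK.
  apply: exec_le_seq (exec_clear _ _) _.
  exact: exec_transfer.
- rewrite /upd /= size_rev !size_cells /dsize /tsize /= size_cat /tsize; lia.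
- case=> [|[|[|i]]]; rewrite /upd /= ?catrevE ?revK ?cats0 //.
  by rewrite sK.
Qed.

Lemma ptime_snd_proj {A B : Type} {dA : data A} {dB : data B} :
  ptime (fun p : A * B => p.2).
Proof.
exists (Seq (Seq (Pop 0) (Seq (Push 1 (inr true)) scan)) (clear 2)), 3,
  (fun p => 9 * dsize p + 5).
split.
  apply: pboundD (pbound_const _ _); apply: pboundM (pbound_id _).
  exact: pbound_const.
move=> [a b] s /= s0 sK; apply: exec_le_weaken.
- apply: exec_le_seq; first by apply: exec_split s0 _ _; apply: sK.
  exact: exec_clear.
- rewrite /upd /= size_rev !size_cells /dsize /tsize /= size_cat /tsize; lia.
- by case=> [|[|[|i]]]; rewrite /upd //= sK.
Qed.

(** * Projections and branching *)

Section Branching.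
Context {X A B : Type} {dX : data X} {dA : data A} {dB : data B}.

Lemma ptime_fst (f : X -> A * B) : ptime f -> ptime (fun x => (f x).1).
Proof. exact: ptime_comp ptime_fst_proj. Qed.

Lemma ptime_snd (f : X -> A * B) : ptime f -> ptime (fun x => (f x).2).
Proof. exact: ptime_comp ptime_snd_proj. Qed.

Lemma ptime_pair (f : X -> A) (g : X -> B) :
  ptime f -> ptime g -> ptime (fun x => (f x, g x)).
Proof. exact: ptime_node. Qed.

Lemma ptime_cons (f : X -> A) (g : X -> seq A) :
  ptime f -> ptime g -> ptime (fun x => f x :: g x).
Proof. exact: ptime_node. Qed.

Lemma ptime_if (b : X -> bool) (f g : X -> A) :
  ptime b -> ptime f -> ptime g -> ptime (fun x => if b x then f x else g x).
Proof.
move=> pb [p [Kp [Tp [bp hp]]]] [q [Kq [Tq [bq hq]]]].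
have [c [Kc [Tc [bc hc]]]] := ptime_node pb ptime_id.
(* Below the roots of the pair and of the boolean lies the truth value; it and the rest of the
   five-letter code, four letters in all, are dropped after the test. *)
pose drop4 (r : prog) :=
  Seq (Pop 0) (Seq (Pop 0) (Seq (Pop 0) (Seq (Pop 0) r))).
exists (Seq c (Seq (Pop 0) (Seq (Pop 0) (Case 0 (fun a =>
         drop4 (if a is Some (inr true) then p else q)))))).
exists (maxn Kc (maxn Kp Kq)), (fun x => Tc x + (Tp x + Tq x + 7)); split.
  exact: pboundD bc (pboundD (pboundD bp bq) (pbound_const _ _)).
move=> x; apply: maps_seq (maps_weaken (hc x) (leq_maxl _ _) (leqnn _)) _.
have hp' : maps p (maxn Kc (maxn Kp Kq)) (Tp x) (enc x) (enc (f x)).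
  by apply: maps_weaken (hp x) _ _; lia.
have hq' : maps q (maxn Kc (maxn Kp Kq)) (Tq x) (enc x) (enc (g x)).
  by apply: maps_weaken (hq x) _ _; lia.
pose h := if b x then f x else g x; pose r := if b x then p else q.
have {hp' hq'} hr :
    maps r (maxn Kc (maxn Kp Kq)) (Tp x + Tq x) (enc x) (enc h).
  rewrite /r /h; case: (b x);
    [apply: maps_weaken hp' _ _ | apply: maps_weaken hq' _ _]; lia.
move=> s s0 sK; rewrite cells_Node in s0.
apply: (@exec_le_weaken _ _
         (1 + (1 + (1 + (1 + (1 + (1 + (Tp x + Tq x)))).+1)))).
- apply: exec_le_seq (exec_le_pop _ _) _.
  apply: exec_le_seq (exec_le_pop _ _) _.
  apply: exec_le_case.
  rewrite [ohead _](_ : _ = Some (inr (b x))); last first.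
    by rewrite /upd /= s0; case: (b x).
  do 4 apply: exec_le_seq (exec_le_pop _ _) _.
  rewrite -/r; apply: hr.
    by rewrite /upd /= s0; case: (b x).
  by move=> i /andP[i0 iK]; rewrite /upd (gtn_eqF i0) sK ?i0.
- by lia.
- by rewrite /upd => i; case: eqP.
Qed.

End Branching.

Lemma ptime_case_seq {X A B : Type} {dX : data X} {dA : data A} {dB : data B}
    (l : X -> seq A) (f : X -> B) (g : X -> A -> seq A -> B) :
  ptime l -> ptime f ->
  ptime (fun y : A * seq A * X => g y.2 y.1.1 y.1.2) ->
  ptime (fun x => if l x is a :: m then g x a m else f x).
Proof.
move=> pl [p [Kp [Tp [bp hp]]]] [q [Kq [Tq [bq hq]]]].
have [c [Kc [Tc [bc hc]]]] := ptime_node pl ptime_id.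
have bl := dsize_ptime pl.
pose K := maxn Kc (maxn Kp Kq).
(* A nonempty list has the code of the pair of its head and tail, so restoring the popped root gives
   the code of [(a, m, x)]. *)
exists (Seq c (Seq (Pop 0) (Case 0 (fun a =>
  if a is Some (inr true) then Seq (Push 0 (inr true)) q
  else Seq (Pop 0) p)))).
exists K, (fun x =>
  Tc x + (Tp x + (if l x is a :: m then Tq (a, m, x) else 0) + 4)).
split.
  apply: pboundD bc (pboundD (pboundD bp _) (pbound_const _ _)).
  case: bq => e he.
  have bS := pboundD bl (pboundD (pbound_id _) (pbound_const _ 1)).
  apply: leq_pbound (pbound_trans bS _); last first.
    by exists e => x; apply: leqnn.
  move=> x /=; case: (l x) => [|a m]; first by [].
  apply: leq_trans (he _) _; apply: leq_expl.
  by rewrite /dsize /tsize /= !size_cat; lia.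
move=> x; apply: maps_seq (maps_weaken (hc x) (leq_maxl _ _) (leqnn _)) _.
move=> s s0 sK; rewrite cells_Node in s0.
case e: (l x) s0 => [|a m] s0.
  apply: (@exec_le_weaken _ _ (1 + (1 + Tp x).+1)).
  - apply: exec_le_seq (exec_le_pop _ _) _; apply: exec_le_case.
    rewrite [ohead _](_ : _ = Some (inr false)); last by rewrite /upd /= s0.
    apply: exec_le_seq (exec_le_pop _ _) _.
    apply: (maps_weaken (hp x) (K' := K) _ (leqnn _)).
    + by lia.
    + by rewrite /upd /= s0.
    + by move=> i /andP[i0 iK]; rewrite /upd (gtn_eqF i0) sK ?i0.
  - by lia.
  - by rewrite /upd => i; case: eqP.
apply: (@exec_le_weaken _ _ (1 + (2 + Tq (a, m, x)).+1)).
- apply: exec_le_seq (exec_le_pop _ _) _; apply: exec_le_case.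
  rewrite [ohead _](_ : _ = Some (inr true)); last by rewrite /upd /= s0.
  apply: exec_le_seq (exec_le_push _ _ _) _.
  apply: (maps_weaken (hq (a, m, x)) (K' := K) _ (leqnn _)).
  + by lia.
  + by rewrite /upd /= s0 -cells_Node.
  + by move=> i /andP[i0 iK]; rewrite /upd (gtn_eqF i0) sK ?i0.
- by lia.
- by rewrite /upd => i; case: eqP.
Qed.

(** * Bounded iteration *)

Section Iteration.
Context {X A : Type} {dX : data X} {dA : data A}.

(** A copy of the initial code is the unary clock, losing one letter per round. [H] bounds all
    intermediate values, whose sizes could otherwise grow exponentially. *)
Lemma ptime_iter (h : X -> A) (g : A -> A) (H : X -> nat) :
  ptime h -> ptime g -> pbound dsize H ->
  (forall x i, i <= dsize (h x) -> dsize (iter i g (h x)) <= H x) ->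
  ptime (fun x => iter (dsize (h x)) g (h x)).
Proof.
move=> ph [p [Kp [T [[c hT] hp]]]] bH leH; have bh := dsize_ptime ph.
have [q [Kq [Tq [bq hq]]]] := ph; pose K := maxn Kp Kq.
pose M x := (H x + 2) ^ c.
exists (Seq q (Seq (duplicate 0 K.+1 K.+2)
                (While K.+2 (Seq (Pop K.+2) p)))), K.+3.
exists (fun x => Tq x + (12 * dsize (h x) + 2 + (dsize (h x) * (M x + 2) + 1))).
split.
  have bM : pbound dsize M by apply: pbound_trans bH _; exists c.
  do ! [apply: pboundD | apply: pboundM | apply: pbound_const
       | apply: bh | apply: bq | apply: bM].
move=> x; apply: maps_seq; first by apply: maps_weaken (hq x) _ _; lia.
move=> s s0 sK.
have s1 : s K.+1 = [::] by apply: sK; lia.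
have s2 : s K.+2 = [::] by apply: sK; lia.
have loop n b v (u : store) : u 0 = cells (enc b) -> u K.+2 = v ->
    (forall i, 0 < i < K -> u i = [::]) -> size v = n ->
    (forall i, i < n -> T (iter i g b) <= M x) ->
    exec_le (While K.+2 (Seq (Pop K.+2) p)) u (n * (M x + 2) + 1)
      (upd (upd u K.+2 [::]) 0 (cells (enc (iter n g b)))).
  elim: n b v u => [|n IH] b [|y v] u u0 uv uK //= sv leT.
    apply: (exec_le_weaken (exec_le_while0 _ uv)) => // i.
    by rewrite /upd; case: eqP => [->//|_]; case: eqP => [->//|].
  have T0 := leT 0 isT.
  apply: (@exec_le_weaken _ _ (1 + T b + (n * (M x + 2) + 1)).+1).
  - apply: exec_le_whileS; first by rewrite uv.
      apply: exec_le_seq (exec_le_pop _ _) _.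
      apply: (maps_weaken (hp b) (leq_maxl _ Kq) (leqnn _)).
        by rewrite /upd.
      by move=> i iK; rewrite /upd ifF ?uK //; lia.
    apply: IH; first by rewrite /upd.
    + by rewrite /upd /= eqxx uv.
    + by move=> i /andP[i0 iK]; rewrite /upd (gtn_eqF i0) ifF ?uK ?i0 //; lia.
    + by case: sv.
    + by move=> i lt_i; rewrite -iterSr; apply: leT.
  - by rewrite /= in T0; nia.
  - by move=> i; rewrite -iterSr /upd; case: eqP => // _; case: eqP.
apply: exec_le_weaken.
- apply: exec_le_seq; first by apply: exec_duplicate; rewrite // ?eqn_leq; lia.
  apply: (loop (dsize (h x)) (h x) (s 0)); rewrite /upd ?eqxx //.
  + by move=> i iK; rewrite ifF ?sK //; lia.
  + by rewrite s0 size_cells.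
  + move=> i lt_i; apply: leq_trans (hT _) _; apply: leq_expl.
    by rewrite leq_add2r leH // ltnW.
- by rewrite s0 size_cells /dsize; lia.
- by move=> i; rewrite /upd; case: eqP => // _; case: eqP => // ->; rewrite s2.
Qed.

End Iteration.

(** * Recursion on lists *)

Section DataSizes.
Context {A B : Type} {dA : data A} {dB : data B}.

Lemma dsize_pair (p : A * B) : dsize p = (dsize p.1 + dsize p.2).+1.
Proof. by rewrite /dsize /tsize /= size_cat. Qed.

Lemma dsize_cons (a : A) l : dsize (a :: l) = (dsize a + dsize l).+1.
Proof. by rewrite /dsize /tsize /= size_cat. Qed.

Lemma dsize_nil : dsize ([::] : seq A) = 1.
Proof. by []. Qed.

Lemma dsize_bool (b : bool) : dsize b = 5.
Proof. by case: b. Qed.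

Lemma size_leq_dsize (l : seq A) : size l <= dsize l.
Proof. by elim: l => //= a l IH; rewrite dsize_cons; lia. Qed.

End DataSizes.

Lemma ptime_foldl_bounded {X A B : Type}
    {dX : data X} {dA : data A} {dB : data B} (f : X -> B -> A -> B)
    (b : X -> B) (l : X -> seq A) (H : X -> nat) :
  ptime (fun p : X * B * A => f p.1.1 p.1.2 p.2) -> ptime b -> ptime l ->
  pbound dsize H ->
  (forall x n, dsize (foldl (f x) (b x) (take n (l x))) <= H x) ->
  ptime (fun x => foldl (f x) (b x) (l x)).
Proof.
move=> pf pb pl bH leH.
(* One step of the fold on parameter, accumulator and remaining list. It is stationary once the list
   is empty, so surplus rounds of the clock are harmless. *)
pose g (s : X * B * seq A) :=
  if s.2 is a :: m then (s.1.1, f s.1.1 s.1.2 a, m) else s.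
pose h x := (x, b x, l x).
have ph : ptime h.
  by apply: ptime_pair pl; apply: ptime_pair pb; apply: ptime_id.
have pg : ptime g.
  apply: (@ptime_case_seq _ _ _ _ _ _ (fun s : X * B * seq A => s.2) id
    (fun s a m => (s.1.1, f s.1.1 s.1.2 a, m))).
  - exact: ptime_snd ptime_id.
  - exact: ptime_id.
  apply: ptime_pair; last exact: ptime_snd (ptime_fst ptime_id).
  have p1 : ptime (fun y : A * seq A * (X * B * seq A) => y.2.1.1).
    exact: ptime_fst (ptime_fst (ptime_snd ptime_id)).
  apply: (ptime_pair p1).
  apply: (ptime_comp (g := fun p => f p.1.1 p.1.2 p.2)
    (f := fun y : A * seq A * (X * B * seq A) => (y.2.1.1, y.2.1.2, y.1.1)) pf).
  apply: ptime_pair (ptime_fst (ptime_fst ptime_id)).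
  apply: (ptime_pair p1).
  exact: ptime_snd (ptime_fst (ptime_snd ptime_id)).
have iterE x n : iter n g (h x)
    = (x, foldl (f x) (b x) (take n (l x)), drop n (l x)).
  elim: n => [|n IH]; first by rewrite take0 drop0.
  rewrite iterS IH /g /=; case e: (drop n (l x)) => [|a m].
    have le : size (l x) <= n by rewrite -subn_eq0 -size_drop e.
    by rewrite !take_oversize ?drop_oversize // leqW.
  have lt : n < size (l x) by rewrite -subn_gt0 -size_drop e.
  have := drop_nth a lt; rewrite e => -[ea ->].
  by rewrite (take_nth a lt) foldl_rcons -ea.
apply: (@ptime_ext _ _ _ _ (fun x => (iter (dsize (h x)) g (h x)).1.2)) => [x|].
  rewrite iterE take_oversize //; apply: leq_trans (size_leq_dsize _) _.
  by rewrite dsize_pair /=; lia.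
apply/ptime_snd/ptime_fst.
have bl := dsize_ptime pl.
apply: (ptime_iter (H := fun x => dsize x + (H x + (dsize (l x) + 2)))) => //.
  by do ! [apply: pboundD | apply: pbound_const | apply: pbound_id].
move=> x n _; rewrite iterE !dsize_pair /=; have := leH x n.
have : dsize (drop n (l x)) <= dsize (l x); last by lia.
elim: (l x) n => [|a m IH] [|n] //=; rewrite dsize_cons.
by apply: leq_trans (IH n) _; lia.
Qed.

(* [Phi] is a potential that each step increases by an amount independent of
   the accumulator. *)
Lemma ptime_foldl {X A B : Type} {dX : data X} {dA : data A} {dB : data B}
    (Phi : B -> nat) (G : X * A -> nat)
    (f : X -> B -> A -> B) (b : X -> B) (l : X -> seq A) :
  pbound Phi dsize -> pbound dsize Phi -> pbound dsize G ->
  (forall x acc a, Phi (f x acc a) <= Phi acc + G (x, a)) ->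
  ptime (fun p : X * B * A => f p.1.1 p.1.2 p.2) -> ptime b -> ptime l ->
  ptime (fun x => foldl (f x) (b x) (l x)).
Proof.
move=> bPhi bPhi' [c hG] step pf pb pl.
have bb := dsize_ptime pb; have bl := dsize_ptime pl.
(* [dsize (l x)] bounds both the number of steps and the size of each entry; 3 is the 2 of [pbound]
   plus the root of the pair [(x, a)]. *)
pose (W := fun x => Phi (b x) + dsize (l x) * (dsize x + dsize (l x) + 3) ^ c).
have [d hd] := bPhi.
apply: (ptime_foldl_bounded (H := fun x => (W x + 2) ^ d)) => //.
  apply: (@pbound_trans _ _ _ W); last by exists d.
  apply: pboundD; first exact: pbound_comp bPhi' bb.
  apply: pboundM => //.
  apply: (@pbound_trans _ _ _ (fun x => dsize x + dsize (l x) + 1)).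
    by apply: pboundD (pbound_const _ _); apply: pboundD (pbound_id _) bl.
  by exists c => x; rewrite -(addnA _ 1 2).
move=> x n; apply: leq_trans (hd _) _; apply: leq_expl; rewrite leq_add2r.
have {}hG a : dsize a <= dsize (l x) ->
    G (x, a) <= (dsize x + dsize (l x) + 3) ^ c.
  move=> le_a; apply: leq_trans (hG _) _; apply: leq_expl.
  by rewrite dsize_pair /=; lia.
rewrite /W; set M := _ ^ c in hG *.
have sub m acc : (forall a, dsize a <= dsize m -> G (x, a) <= M) ->
    Phi (foldl (f x) acc m) <= Phi acc + dsize m * M.
  elim: m acc => [|a m IH] acc hM /=; first by rewrite leq_addr.
  have e := dsize_cons a m; have hs := step x acc a.
  have ha : G (x, a) <= M by apply: hM; rewrite e; lia.
  apply: leq_trans (IH _ _) _; first by move=> a' ?; apply: hM; rewrite e; lia.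
  by rewrite e mulSn mulnDl; lia.
have le_take : dsize (take n (l x)) <= dsize (l x).
  elim: (l x) (n) => [|a m IH] [|k] //=; rewrite !dsize_cons; have := IH k; lia.
apply: leq_trans (sub _ _ _) _.
  by move=> a le_a; apply: hG; apply: leq_trans le_take.
by rewrite leq_add2l leq_mul2r le_take orbT.
Qed.

Lemma ptime_app2 {X A B C : Type} {dX : data X} {dA : data A} {dB : data B}
    {dC : data C} (g : A -> B -> C) (e1 : X -> A) (e2 : X -> B) :
  ptime (fun p : A * B => g p.1 p.2) -> ptime e1 -> ptime e2 ->
  ptime (fun x => g (e1 x) (e2 x)).
Proof. by move=> pg p1 p2; apply: (ptime_comp pg (ptime_pair p1 p2)). Qed.

Lemma ptime_app3 {X A B C D : Type} {dX : data X} {dA : data A} {dB : data B}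
    {dC : data C} {dD : data D} (g : A -> B -> C -> D)
    (e1 : X -> A) (e2 : X -> B) (e3 : X -> C) :
  ptime (fun p : A * B * C => g p.1.1 p.1.2 p.2) ->
  ptime e1 -> ptime e2 -> ptime e3 ->
  ptime (fun x => g (e1 x) (e2 x) (e3 x)).
Proof.
move=> pg p1 p2 p3.
exact: (ptime_comp pg (ptime_pair (ptime_pair p1 p2) p3)).
Qed.

Ltac ptime_hyp :=
  match goal with H : ptime _ |- _ =>
    first [exact H | apply: (ptime_app3 H) | apply: (ptime_app2 H)
          | refine (ptime_comp H _)] end.

Ltac ptime_step :=
  lazymatch goal with
  | |- ptime fst => exact ptime_fst_proj
  | |- ptime snd => exact ptime_snd_proj
  | |- ptime (fun x => x) => exact ptime_id
  | |- ptime (fun _ => ?b) => exact (ptime_const b)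
  | |- ptime (fun x => (@?f x).1) => apply (ptime_fst (f := f))
  | |- ptime (fun x => (@?f x).2) => apply (ptime_snd (f := f))
  | |- ptime (fun x => (@?f x, @?g x)) => apply (ptime_pair (f := f) (g := g))
  | |- ptime (fun x => @?f x :: @?g x) => apply (ptime_cons (f := f) (g := g))
  | _ => first [ptime_hyp | apply ptime_if | apply ptime_case_seq]
  end.

Ltac ptime_auto := repeat (cbn beta; ptime_step).

Section Booleans.
Context {X : Type} {dX : data X}.
Implicit Types f g : X -> bool.

Lemma ptime_andb f g : ptime f -> ptime g -> ptime (fun x => f x && g x).
Proof. by move=> pf pg; rewrite /andb; ptime_auto. Qed.

Lemma ptime_negb f : ptime f -> ptime (fun x => ~~ f x).
Proof. by move=> pf; rewrite /negb; ptime_auto. Qed.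

Lemma ptime_orb f g : ptime f -> ptime g -> ptime (fun x => f x || g x).
Proof. by move=> pf pg; rewrite /orb; ptime_auto. Qed.

Lemma ptime_addb f g : ptime f -> ptime g -> ptime (fun x => f x (+) g x).
Proof.
move=> pf pg.
apply: (@ptime_ext _ _ _ _ (fun x => if f x then ~~ g x else g x)).
  by move=> x; case: (f x).
by have pn := ptime_negb pg; ptime_auto.
Qed.

End Booleans.

(** * Standard list operations *)

Section Lists.
Context {X A B : Type} {dX : data X} {dA : data A} {dB : data B}.
Implicit Types l : X -> seq A.

Lemma ptime_foldl_additive (G : X * A -> nat) (f : X -> B -> A -> B) b l :
  pbound dsize G ->
  (forall x acc a, dsize (f x acc a) <= dsize acc + G (x, a)) ->
  ptime (fun p : X * B * A => f p.1.1 p.1.2 p.2) -> ptime b -> ptime l ->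
  ptime (fun x => foldl (f x) (b x) (l x)).
Proof. by apply: ptime_foldl; apply: pbound_id. Qed.

End Lists.

Lemma ptime_rev {X A : Type} {dX : data X} {dA : data A} (l : X -> seq A) :
  ptime l -> ptime (fun x => rev (l x)).
Proof.
move=> pl; apply: (@ptime_ext _ _ _ _ (fun x =>
  foldl (fun acc a => a :: acc) [::] (l x))) => [x|].
  by elim/last_ind: (l x) => // m a IH; rewrite foldl_rcons IH rev_rcons.
apply: (ptime_foldl_additive (G := fun p : X * A => dsize p)).
- exact: pbound_id.
- by move=> x acc a; rewrite dsize_pair dsize_cons /=; lia.
- by ptime_auto.
- by ptime_auto.
- by [].
Qed.

Section FoldRight.
Context {X A B : Type} {dX : data X} {dA : data A} {dB : data B}.
Implicit Types l : X -> seq A.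

Lemma ptime_foldr (G : X * A -> nat) (f : X -> A -> B -> B) b l :
  pbound dsize G ->
  (forall x acc a, dsize (f x a acc) <= dsize acc + G (x, a)) ->
  ptime (fun p : X * A * B => f p.1.1 p.1.2 p.2) -> ptime b -> ptime l ->
  ptime (fun x => foldr (f x) (b x) (l x)).
Proof.
move=> bG leG pf pb pl.
apply: (@ptime_ext _ _ _ _ (fun x =>
  foldl (fun acc a => f x a acc) (b x) (rev (l x)))) => [x|].
  by rewrite foldl_rev.
apply: (ptime_foldl_additive (f := fun x acc a => f x a acc) bG) => //.
  by ptime_auto.
exact: ptime_rev.
Qed.

End FoldRight.

Section MoreLists.
Context {X A B : Type} {dX : data X} {dA : data A} {dB : data B}.
Implicit Types l : X -> seq A.

Lemma ptime_map (f : X -> A -> B) l :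
  ptime (fun p : X * A => f p.1 p.2) -> ptime l ->
  ptime (fun x => [seq f x a | a <- l x]).
Proof.
move=> pf pl; apply: (@ptime_ext _ _ _ _ (fun x =>
  foldr (fun a acc => f x a :: acc) [::] (l x))) => [x|].
  by elim: (l x) => //= a s ->.
apply: (ptime_foldr (G := fun p : X * A => dsize (f p.1 p.2) + 1)
  (f := fun x a acc => f x a :: acc)) => //.
- apply: pboundD (pbound_const _ _); exact: dsize_ptime pf.
- by move=> x acc a; rewrite dsize_cons /=; lia.
- by ptime_auto.
- by ptime_auto.
Qed.

Lemma ptime_filter (p : X -> A -> bool) l :
  ptime (fun q : X * A => p q.1 q.2) -> ptime l ->
  ptime (fun x => [seq a <- l x | p x a]).
Proof.
move=> pp pl; apply: (@ptime_ext _ _ _ _ (fun x =>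
  foldr (fun a acc => if p x a then a :: acc else acc) [::] (l x))) => [x|].
  by elim: (l x) => //= a s ->.
apply: (ptime_foldr (G := dsize)
  (f := fun x a acc => if p x a then a :: acc else acc)) => //.
- exact: pbound_id.
- by move=> x acc a; rewrite dsize_pair /=; case: ifP; rewrite ?dsize_cons; lia.
- by ptime_auto.
- by ptime_auto.
Qed.

Lemma ptime_all (p : X -> A -> bool) l :
  ptime (fun q : X * A => p q.1 q.2) -> ptime l ->
  ptime (fun x => all (p x) (l x)).
Proof.
move=> pp pl; apply: (@ptime_ext _ _ _ _ (fun x =>
  foldr (fun a acc => p x a && acc) true (l x))) => [x|].
  by elim: (l x) => //= a s ->.
apply: (ptime_foldr (G := fun=> 5) (f := fun x a acc => p x a && acc)) => //.
- exact: pbound_const.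
- by move=> x acc a; rewrite !dsize_bool.
- by apply: ptime_andb; ptime_auto.
- by ptime_auto.
Qed.

Lemma ptime_cat (l m : X -> seq A) :
  ptime l -> ptime m -> ptime (fun x => l x ++ m x).
Proof.
move=> pl pm; apply: (@ptime_ext _ _ _ _ (fun x =>
  foldr cons (m x) (l x))) => [x|].
  by elim: (l x) => //= a s ->.
apply: (ptime_foldr (G := dsize) (f := fun _ => cons)) => //.
- exact: pbound_id.
- by move=> x acc a; rewrite dsize_pair dsize_cons /=; lia.
- by ptime_auto.
Qed.

Lemma ptime_zip l (m : X -> seq B) :
  ptime l -> ptime m -> ptime (fun x => zip (l x) (m x)).
Proof.
move=> pl pm.
(* The remainder of the second list, and the pairs so far in reverse. Entries of the second list
   only move from one to the other, so the growth per step is bounded in terms of [a]. *)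
pose f (acc : seq B * seq (A * B)) (a : A) :=
  if acc.1 is b :: m' then (m', (a, b) :: acc.2) else acc.
apply: (@ptime_ext _ _ _ _ (fun x =>
  rev (foldl f (m x, [::]) (l x)).2)) => [x|].
  rewrite -[RHS]cat0s -[X in X ++ _]/(rev [::]); move: (m x) [::].
  elim: (l x) => [|a s IH] [|b t] acc /=; rewrite ?cats0 //.
    by rewrite IH; case: (s); rewrite /= cats0.
  by rewrite IH rev_cons cat_rcons.
apply: ptime_rev; apply: ptime_snd.
apply: (ptime_foldl_additive (G := fun p : X * A => dsize p)
         (f := fun=> f)) => //.
- exact: pbound_id.
- move=> x [[|b t] acc] a; rewrite /f /= ?dsize_pair /= ?dsize_cons.
    by lia.
  by rewrite ?dsize_pair /=; lia.
- by rewrite /f; ptime_auto.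
- by ptime_auto.
Qed.

End MoreLists.

Lemma ptime_eq_seq {X : Type} {A : eqType} {dX : data X} {dA : data A}
    (l m : X -> seq A) :
  ptime (fun p : A * A => p.1 == p.2) ->
  ptime l -> ptime m -> ptime (fun x => l x == m x).
Proof.
move=> pe pl pm.
(* The flag is cleared on a mismatch or when the second list runs out; a remainder at the end means
   that the first list was shorter. *)
pose f (acc : seq A * bool) (a : A) :=
  if acc.1 is b :: m' then (m', acc.2 && (a == b)) else ([::], false).
apply: (@ptime_ext _ _ _ _ (fun x =>
    let r := foldl f (m x, true) (l x) in
    if r.1 is _ :: _ then false else r.2)) => [x|].
  have foldl_false s t : (foldl f (t, false) s).2 = false.
    by elim: s t => //= a s IH [|b t]; apply: IH.
  have foldl_nil b s : (foldl f ([::], b) s).1 = [::].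
    by elim: s b => //= a s IH b; apply: IH.
  rewrite /=; elim: (l x) (m x) => [|a s IH] [|b t] //=.
    by rewrite foldl_nil foldl_false.
  have -> : f (b :: t, true) a = (t, a == b) by [].
  rewrite eqseq_cons; case: (a == b) => /=; first exact: IH.
  by rewrite foldl_false; case: (foldl _ _ _).1.
have pf : ptime (fun x => foldl f (m x, true) (l x)).
  apply: (ptime_foldl_additive (G := fun=> 1) (f := fun=> f)) => //.
  - exact: pbound_const.
  - move=> x [[|b t] acc] a.
      by rewrite /f /= !dsize_pair /= !dsize_bool; lia.
    by rewrite /f /= !dsize_pair /= dsize_cons !dsize_bool; lia.
  - rewrite /f; ptime_auto; apply: ptime_andb; ptime_auto.
  - by ptime_auto.
by rewrite /=; ptime_auto.
Qed.

(** * Binary arithmetic *)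

(** The digits of [enc_nat] as booleans; zero has none. *)
Definition bits n := mkseq (fun i => odd (n %/ 2 ^ i)) (up_log 2 n.+1).

#[export] Instance nat_data : data nat := fun n => enc (bits n).

Lemma bits_half n : 0 < n -> bits n = odd n :: bits n./2.
Proof.
move=> n0; rewrite /bits (up_log2S n0) /mkseq /= divn1; congr (_ :: _).
rewrite -[1]/(1 + 0) iotaDl -map_comp; apply: eq_map => i /=.
by rewrite add1n expnS divnMA divn2.
Qed.

Lemma size_bits n : size (bits n) = up_log 2 n.+1.
Proof. exact: size_mkseq. Qed.

Lemma ltn_expn_bits n : n < 2 ^ size (bits n).
Proof. by rewrite size_bits; apply: up_logP. Qed.

Lemma size_bits_leq n k : n < 2 ^ k -> size (bits n) <= k.
Proof. by rewrite size_bits; apply: up_log_min. Qed.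

Lemma dsize_nat n : dsize n = 6 * size (bits n) + 1.
Proof.
rewrite -[dsize n]/(dsize (bits n)).
by elim: (bits n) => // b l IH; rewrite dsize_cons dsize_bool IH /=; lia.
Qed.

Lemma size_bitsD m n : size (bits (m + n)) <= size (bits m) + size (bits n) + 1.
Proof.
apply: size_bits_leq; rewrite addn1 expnS expnD.
have := ltn_expn_bits m; have := ltn_expn_bits n.
by set x := 2 ^ _; set y := 2 ^ _ => *; nia.
Qed.

Lemma size_bitsM m n : size (bits (m * n)) <= size (bits m) + size (bits n).
Proof.
by apply: size_bits_leq; rewrite expnD; apply: ltn_mul; apply: ltn_expn_bits.
Qed.

Lemma size_bits_double (b : bool) n :
  size (bits (b + n.*2)) <= size (bits n) + 1.
Proof.
apply: size_bits_leq; rewrite addn1 expnS; have := ltn_expn_bits n.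
by case: b => /=; lia.
Qed.

(** Ripple-carry addition on remaining operands, carry and reversed output. The first branch stops
    before a leading zero is emitted. *)
Definition add_step (st : nat * nat * bool * seq bool) :=
  let m := st.1.1.1 in let n := st.1.1.2 in let c := st.1.2 in
  if (m == 0) && ((n == 0) && ~~ c) then st
  else (m./2, n./2, if odd m then odd n || c else odd n && c,
        odd m (+) odd n (+) c :: st.2).

(** The list [s] is a clock: its length must reach the number of digits of the sum. *)
Lemma add_loop (s : seq bool) m n (c : bool) out : m + n + c < 2 ^ size s ->
  rev (foldl (fun st _ => add_step st) (m, n, c, out) s).2
    = rev out ++ bits (m + n + c).
Proof.
elim: s m n c out => [|x s IH] m n c out /=.
  by rewrite expn0 ltnS leqn0 => /eqP ->; rewrite cats0.
move=> lt; rewrite {2}/add_step /=; case: ifP => [|nz].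
  move=> /andP[/eqP e1 /andP[/eqP e2 /negbTE e3]]; subst; apply: IH.
  by rewrite expn_gt0.
set c' := if _ then _ else _.
have half : (m + n + c)./2 = m./2 + n./2 + c'.
  move: (odd_double_half m) (odd_double_half n); rewrite /c'.
  by case: (odd m); case: (odd n); case: (c) => /=; lia.
rewrite IH -half; last by rewrite expnS in lt; lia.
rewrite rev_cons cat_rcons [in RHS]bits_half; last first.
  by move: nz; case: (m) => //; case: (n) => //; case: (c).
by rewrite !oddD oddb.
Qed.

(** Digits are compared from the least significant on, so a later difference overrides the verdict
    so far. *)
Definition leq_step (st : nat * nat * bool) :=
  let m := st.1.1 in let n := st.1.2 in
  (m./2, n./2, if odd m == odd n then st.2 else odd n).

Lemma leq_loop (s : seq bool) m n (r : bool) :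
  m < 2 ^ size s -> n < 2 ^ size s ->
  (foldl (fun st _ => leq_step st) (m, n, r) s).2
    = if m == n then r else m < n.
Proof.
elim: s m n r => [|x s IH] m n r /=.
  by rewrite expn0 !ltnS !leqn0 => /eqP -> /eqP ->.
rewrite expnS => ltm ltn; rewrite {2}/leq_step /= IH; [|lia|lia].
by do ! case: ifP; lia.
Qed.

Section Digits.
Context {X : Type} {dX : data X}.
Implicit Types m n : X -> nat.

Lemma ptime_bits n : ptime n -> ptime (fun x => bits (n x)).
Proof. exact: ptime_same_enc. Qed.

Lemma ptime_of_bits n : ptime (fun x => bits (n x)) -> ptime n.
Proof. exact: ptime_same_enc. Qed.

Lemma ptime_eq0 n : ptime n -> ptime (fun x => n x == 0).
Proof.
move=> /ptime_bits pn.
apply: (@ptime_ext _ _ _ _ (fun x =>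
  if bits (n x) is _ :: _ then false else true)).
  by move=> x; case: (posnP (n x)) => [->//|n0]; rewrite bits_half // gtn_eqF.
by ptime_auto.
Qed.

Lemma ptime_odd n : ptime n -> ptime (fun x => odd (n x)).
Proof.
move=> /ptime_bits pn.
apply: (@ptime_ext _ _ _ _ (fun x =>
  if bits (n x) is b :: _ then b else false)).
  by move=> x; case: (posnP (n x)) => [->//|n0]; rewrite bits_half.
by ptime_auto.
Qed.

Lemma ptime_half n : ptime n -> ptime (fun x => (n x)./2).
Proof.
move=> /ptime_bits pn; apply: ptime_of_bits.
apply: (@ptime_ext _ _ _ _ (fun x => if bits (n x) is _ :: l then l else [::])).
  by move=> x; case: (posnP (n x)) => [->//|n0]; rewrite [bits (n x)]bits_half.
by ptime_auto.
Qed.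

(** This prefixes a digit, except that a 0 in front of zero would be a leading zero. *)
Lemma ptime_add_double (b : X -> bool) n :
  ptime b -> ptime n -> ptime (fun x => b x + (n x).*2).
Proof.
move=> pb pn; apply: ptime_of_bits.
apply: (@ptime_ext _ _ _ _ (fun x =>
  if b x || ~~ (n x == 0) then b x :: bits (n x) else [::])).
  move=> x; case: ifP => [nz|]; last by case: (b x); case: (n x).
  rewrite [RHS]bits_half; last by case: (b x) nz; case: (n x).
  by rewrite half_bit_double oddD odd_double addbF; case: (b x).
have pbits := ptime_bits pn.
by apply: ptime_if (ptime_orb _ (ptime_negb (ptime_eq0 _))) _ _; ptime_auto.
Qed.

End Digits.

Section SumAndOrder.
Context {X : Type} {dX : data X}.
Implicit Types m n : X -> nat.

Lemma ptime_addn m n : ptime m -> ptime n -> ptime (fun x => m x + n x).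
Proof.
move=> pm pn; apply: ptime_of_bits.
have pmb := ptime_bits pm; have pnb := ptime_bits pn.
(* The clock has one entry more than both operands have digits together, enough for the last
   carry. *)
apply: (@ptime_ext _ _ _ _ (fun x => rev (foldl (fun st _ => add_step st)
  (m x, n x, false, [::]) (true :: bits (m x) ++ bits (n x))).2)).
  move=> x; rewrite add_loop addn0 //= size_cat expnS expnD.
  have := ltn_expn_bits (m x); have := ltn_expn_bits (n x).
  by set u := 2 ^ _; set v := 2 ^ _ => *; nia.
apply: ptime_rev; apply: ptime_snd.
apply: (ptime_foldl_additive (G := fun=> 6)
         (f := fun _ st (_ : bool) => add_step st)).
- exact: pbound_const.
- move=> _ [[[u v] c] out] _; rewrite /add_step /=.
  case: ifP => _; first by lia.
  rewrite !dsize_pair /= dsize_cons !dsize_bool !dsize_nat.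
  have le k : size (bits k./2) <= size (bits k).
    apply: size_bits_leq; apply: leq_ltn_trans (ltn_expn_bits k).
    by lia.
  by have := le u; have := le v; lia.
- rewrite /add_step; set S := (X * _ * bool)%type.
  have p1 : ptime (fun p : S => p.1.2.1.1.1) by ptime_auto.
  have p2 : ptime (fun p : S => p.1.2.1.1.2) by ptime_auto.
  have p3 : ptime (fun p : S => p.1.2.1.2) by ptime_auto.
  have o1 := ptime_odd p1; have o2 := ptime_odd p2.
  have h1 := ptime_half p1; have h2 := ptime_half p2.
  have cond :=
    ptime_andb (ptime_eq0 p1) (ptime_andb (ptime_eq0 p2) (ptime_negb p3)).
  have sum := ptime_addb (ptime_addb o1 o2) p3.
  have c1 := ptime_orb o2 p3; have c2 := ptime_andb o2 p3.
  apply: ptime_if cond _ _; first by ptime_auto.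
  apply: ptime_pair; last by apply: ptime_cons sum _; ptime_auto.
  by apply: ptime_pair (ptime_pair h1 h2) (ptime_if o1 c1 c2).
- by ptime_auto.
- by apply: ptime_cons (ptime_const _) (ptime_cat pmb pnb).
Qed.

Lemma ptime_leq m n : ptime m -> ptime n -> ptime (fun x => m x <= n x).
Proof.
move=> pm pn; have pmb := ptime_bits pm; have pnb := ptime_bits pn.
apply: (@ptime_ext _ _ _ _ (fun x => (foldl (fun st _ => leq_step st)
  (m x, n x, true) (bits (m x) ++ bits (n x))).2)).
  move=> x; rewrite leq_loop ?size_cat; first by case: ltngtP.
    by apply: leq_trans (ltn_expn_bits _) _; rewrite leq_exp2l // leq_addr.
  by apply: leq_trans (ltn_expn_bits _) _; rewrite leq_exp2l // leq_addl.
apply: ptime_snd.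
apply: (ptime_foldl_additive (G := fun=> 0)
         (f := fun _ st (_ : bool) => leq_step st)).
- exact: pbound_const.
- move=> _ [[u v] r] _; rewrite /leq_step !dsize_pair /= !dsize_bool !dsize_nat.
  have le k : size (bits k./2) <= size (bits k).
    apply: size_bits_leq; apply: leq_ltn_trans (ltn_expn_bits k).
    by lia.
  by have := le u; have := le v; lia.
- rewrite /leq_step; set S := (X * _ * bool)%type.
  have p1 : ptime (fun p : S => p.1.2.1.1) by ptime_auto.
  have p2 : ptime (fun p : S => p.1.2.1.2) by ptime_auto.
  have p3 : ptime (fun p : S => p.1.2.2) by ptime_auto.
  have o1 := ptime_odd p1; have o2 := ptime_odd p2.
  apply: ptime_pair (ptime_pair (ptime_half p1) (ptime_half p2)) _.
  apply: (ptime_if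
    (b := fun p : S => odd p.1.2.1.1 == odd p.1.2.1.2)) => //.
  apply: (@ptime_ext _ _ _ _ (fun p : S =>
    ~~ (odd p.1.2.1.1 (+) odd p.1.2.1.2))).
    by move=> p; case: odd; case: odd.
  exact: ptime_negb (ptime_addb o1 o2).
- by ptime_auto.
- exact: ptime_cat.
Qed.

End SumAndOrder.

Section Product.
Context {X : Type} {dX : data X}.
Implicit Types m n : X -> nat.

(** Horner's scheme on the digits of the first factor: a step lengthens the accumulator by at most
    the length of [n x] and two digits. *)
Lemma ptime_muln m n : ptime m -> ptime n -> ptime (fun x => m x * n x).
Proof.
move=> pm pn; have pmb := ptime_bits pm.
apply: (@ptime_ext _ _ _ _ (fun x =>
  foldr (fun (b : bool) acc => (false + acc.*2) + (if b then n x else 0)) 0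
    (bits (m x)))).
  move=> x; have [k] := ubnP (m x); elim: k (m x) => // k IH u lt_u.
  case: (posnP u) => [->//|u0]; rewrite (bits_half u0) /= IH; last by lia.
  by rewrite -[in RHS](odd_double_half u); case: (odd u); lia.
apply: (ptime_foldr (G := fun p : X * bool => 6 * dsize (n p.1) + 12)
  (f := fun x (b : bool) acc => (false + acc.*2) + (if b then n x else 0))).
- apply: pboundD (pbound_const _ _); apply: pboundM; first exact: pbound_const.
  exact: (dsize_ptime (ptime_comp pn ptime_fst_proj)).
- move=> x acc b; rewrite !dsize_nat [(x, b).1]/=.
  have := size_bitsD (false + acc.*2) (if b then n x else 0).
  have := size_bits_double false acc; set t := false + _.
  have : size (bits (if b then n x else 0)) <= size (bits (n x)) by case: b.
  by lia.
- apply: ptime_addn; last by ptime_auto.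
  by apply: ptime_add_double; ptime_auto.
- by ptime_auto.
- by [].
Qed.

End Product.

(** * Fractions *)

(* [(p, n, d)] stands for [(p - n) / d]. *)
Definition frac := (nat * nat * nat)%type.

Definition frac_add (q r : frac) : frac :=
  (q.1.1 * r.2 + r.1.1 * q.2, q.1.2 * r.2 + r.1.2 * q.2, q.2 * r.2).

Definition frac_mul (q r : frac) : frac :=
  (q.1.1 * r.1.1 + q.1.2 * r.1.2, q.1.1 * r.1.2 + q.1.2 * r.1.1, q.2 * r.2).

(** Cross-multiplication, with the subtracted parts moved to the other side. *)
Definition frac_leq (q r : frac) :=
  q.1.1 * r.2 + r.1.2 * q.2 <= r.1.1 * q.2 + q.1.2 * r.2.

Section FracTime.
Context {X : Type} {dX : data X}.
Variables f g : X -> frac.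
Hypotheses (pf : ptime f) (pg : ptime g).

Ltac frac_auto := rewrite /frac_add /frac_mul /frac_leq;
  repeat first [apply: ptime_leq | apply: ptime_addn | apply: ptime_muln
               | ptime_step].

Lemma ptime_frac_add : ptime (fun x => frac_add (f x) (g x)).
Proof. by frac_auto. Qed.

Lemma ptime_frac_mul : ptime (fun x => frac_mul (f x) (g x)).
Proof. by frac_auto. Qed.

Lemma ptime_frac_leq : ptime (fun x => frac_leq (f x) (g x)).
Proof. by frac_auto. Qed.

End FracTime.

(* The bit length of a sum of fractions is additive in this measure only: the
   encoded size of the sum may contain two copies of the longest component. *)
Definition frac_length (q : frac) :=
  maxn (size (bits q.1.1)) (maxn (size (bits q.1.2)) (size (bits q.2))).

(** The successor pays for the extra bit in [frac_length_add], which makes componentwise addition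
    additive in this measure. *)
Definition fracs_length (v : seq frac) :=
  sumn [seq (frac_length q).+1 | q <- v].

(** Both products are below 2 ^ (k + l), so their sum costs one further bit, whereas [size_bitsD]
    would double the length. *)
Lemma size_bits_addMM m n u v k l :
  size (bits m) <= k -> size (bits n) <= l ->
  size (bits u) <= l -> size (bits v) <= k ->
  size (bits (m * n + u * v)) <= (k + l).+1.
Proof.
have lt w e : size (bits w) <= e -> w < 2 ^ e.
  by move=> le; apply: leq_trans (ltn_expn_bits _) _; rewrite leq_exp2l.
move=> /lt lm /lt ln /lt lu /lt lv; apply: size_bits_leq.
rewrite expnS mul2n -addnn -addSn; apply: leq_add.
  by rewrite expnD ltn_mul.
by rewrite expnD mulnC ltnW // ltn_mul.
Qed.

Lemma frac_length_add q r :
  frac_length (frac_add q r) <= frac_length q + frac_length r + 1.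
Proof.
rewrite [X in X <= _]/frac_length !geq_max addn1.
have [q1 q2 q3] : [/\ size (bits q.1.1) <= frac_length q,
  size (bits q.1.2) <= frac_length q & size (bits q.2) <= frac_length q].
  by rewrite /frac_length; split; lia.
have [r1 r2 r3] : [/\ size (bits r.1.1) <= frac_length r,
  size (bits r.1.2) <= frac_length r & size (bits r.2) <= frac_length r].
  by rewrite /frac_length; split; lia.
apply/and3P; split; [exact: size_bits_addMM | exact: size_bits_addMM |].
by apply: leq_trans (size_bitsM _ _) _; rewrite /=; lia.
Qed.

Lemma dsize_frac (q : frac) :
  frac_length q < dsize q <= 18 * frac_length q + 5.
Proof. by rewrite /frac_length !dsize_pair !dsize_nat; lia. Qed.

Lemma dsize_fracs (v : seq frac) :
  fracs_length v <= dsize v <= 24 * fracs_length v + 1.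
Proof.
elim: v => // q v IH; rewrite dsize_cons /fracs_length /= -/(fracs_length v).
by have := dsize_frac q; lia.
Qed.

(** * Parsing *)

Section Symbols.
Context {X : Type} {dX : data X}.

#[export] Instance symbol_data : data symbol := fun x => enc (symbol_code x).

Lemma ptime_symbol_code (f : X -> symbol) :
  ptime f -> ptime (fun x => symbol_code (f x)).
Proof. exact: ptime_same_enc. Qed.

Lemma dsize_symbol (x : symbol) : dsize x = 17.
Proof. by case: x => [[]|||||]. Qed.

(** A predicate on a finite type is a decision tree over the three bits of the code, with constants
    at its leaves. *)
Lemma ptime_symbol_pred (p : symbol -> bool) (f : X -> symbol) :
  ptime f -> ptime (fun x => p (f x)).
Proof.
move=> /ptime_symbol_code pf; pose P b c d := p (symbol_decode (b, c, d)).
apply: (@ptime_ext _ _ _ _ (fun x => let c := symbol_code (f x) in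
  if c.1.1 then
    if c.1.2 then if c.2 then P true true true else P true true false
    else if c.2 then P true false true else P true false false
  else
    if c.1.2 then if c.2 then P false true true else P false true false
    else if c.2 then P false false true else P false false false)).
  by move=> x; rewrite /P; case: (f x) => [[]|||||].
by rewrite /=; ptime_auto.
Qed.

Lemma ptime_eq_bool (f g : X -> bool) :
  ptime f -> ptime g -> ptime (fun x => f x == g x).
Proof.
move=> pf pg; apply: (@ptime_ext _ _ _ _ (fun x => ~~ (f x (+) g x))).
  by move=> x; case: (f x); case: (g x).
exact: ptime_negb (ptime_addb pf pg).
Qed.

Lemma ptime_eq_symbol (f g : X -> symbol) :
  ptime f -> ptime g -> ptime (fun x => f x == g x).
Proof.
move=> /ptime_symbol_code pf /ptime_symbol_code pg.
apply: (@ptime_ext _ _ _ _ (fun x =>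
  let c := symbol_code (f x) in let d := symbol_code (g x) in
  (c.1.1 == d.1.1) && ((c.1.2 == d.1.2) && (c.2 == d.2)))).
  by move=> x; case: (f x) => [[]|||||]; case: (g x) => [[]|||||].
by rewrite /=; do ! [apply: ptime_andb | apply: ptime_eq_bool]; ptime_auto.
Qed.

End Symbols.

Section Heads.
Context {X A : Type} {dX : data X} {dA : data A}.

Lemma ptime_head (a : A) (l : X -> seq A) :
  ptime l -> ptime (fun x => head a (l x)).
Proof. by move=> pl; rewrite /head; ptime_auto. Qed.

Lemma ptime_behead (l : X -> seq A) :
  ptime l -> ptime (fun x => behead (l x)).
Proof. by move=> pl; rewrite /behead; ptime_auto. Qed.

End Heads.

(* What comes after the last [sep] is dropped. *)
Definition chunks (sep : symbol) (w : seq symbol) : seq (seq symbol) :=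
  foldr (fun x acc => if x == sep then [::] :: acc
                      else if acc is c :: acc' then (x :: c) :: acc' else [::])
        [::] w.

Definition bits_value (w : seq symbol) : nat :=
  foldr (fun x acc => (x == Bit true) + acc.*2) 0 w.

(** The separator is appended because [chunks] drops an unterminated last piece. A sign sends the
    numerator to the subtracted component. *)
Definition parse_frac (w : seq symbol) : frac :=
  let cs := chunks Slash (w ++ [:: Slash]) in
  let num := head [::] cs in let d := bits_value (head [::] (behead cs)) in
  if head Slash num == Minus then (0, bits_value (behead num), d)
  else (bits_value num, 0, d).

(* The row of a state: the words of its coordinates, then its probability
   followed by its utilities. *)
Definition row := (seq (seq symbol) * seq frac)%type.

Definition parse_row (w : seq symbol) : row :=
  let cs := chunks Bar (w ++ [:: Bar]) in
  (chunks Comma (head [::] cs),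
   [seq parse_frac c | c <- chunks Comma (head [::] (behead cs))]).

Section ParseTime.
Context {X : Type} {dX : data X}.
Variable w : X -> seq symbol.
Hypothesis pw : ptime w.

Lemma ptime_chunks sep : ptime (fun x => chunks sep (w x)).
Proof.
rewrite /chunks; apply: (ptime_foldr (G := fun=> 19) (f := fun _ x acc =>
  if x == sep then [::] :: acc
  else if acc is c :: acc' then (x :: c) :: acc' else [::])) => //.
- exact: pbound_const.
- move=> _ acc x; case: ifP => _.
    by rewrite dsize_cons dsize_nil /=; lia.
  by case: acc => [|c acc]; rewrite ?dsize_cons ?dsize_symbol /=; lia.
- apply: ptime_if; last by ptime_auto.
    by apply: (ptime_symbol_pred (fun y => y == sep)); ptime_auto.
  by ptime_auto.
- by ptime_auto.
Qed.

Lemma ptime_bits_value : ptime (fun x => bits_value (w x)).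
Proof.
rewrite /bits_value; apply: (ptime_foldr (G := fun=> 6) (f := fun _ x acc =>
  (x == Bit true) + acc.*2)) => //.
- exact: pbound_const.
- move=> _ acc x; rewrite !dsize_nat.
  by have := size_bits_double (x == Bit true) acc; set t := _ + _; lia.
- apply: ptime_add_double; last by ptime_auto.
  by apply: (ptime_symbol_pred (fun y => y == Bit true)); ptime_auto.
- by ptime_auto.
Qed.

End ParseTime.

Section ParseRowTime.
Context {X : Type} {dX : data X}.
Variable w : X -> seq symbol.
Hypothesis pw : ptime w.

Lemma ptime_parse_frac : ptime (fun x => parse_frac (w x)).
Proof.
have pc : ptime (fun x => chunks Slash (w x ++ [:: Slash])).
  by apply/ptime_chunks/ptime_cat; ptime_auto.
have pn := ptime_head [::] pc.
have pd := ptime_bits_value (ptime_head [::] (ptime_behead pc)).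
have pm := ptime_bits_value (ptime_behead pn).
have pv := ptime_bits_value pn.
have p0 : ptime (fun _ : X => 0) by apply: ptime_const.
rewrite /parse_frac /=; apply: ptime_if.
- apply: (ptime_symbol_pred (fun y => y == Minus)); exact: ptime_head.
- exact: (ptime_pair (ptime_pair p0 pm) pd).
- exact: (ptime_pair (ptime_pair pv p0) pd).
Qed.

End ParseRowTime.

Lemma ptime_parse_row {X : Type} {dX : data X} (w : X -> seq symbol) :
  ptime w -> ptime (fun x => parse_row (w x)).
Proof.
move=> pw; have pc : ptime (fun x => chunks Bar (w x ++ [:: Bar])).
  by apply/ptime_chunks/ptime_cat; ptime_auto.
rewrite /parse_row /=; apply: ptime_pair; first exact/ptime_chunks/ptime_head.
apply: (ptime_map (f := fun=> parse_frac)).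
  by apply: ptime_parse_frac; ptime_auto.
exact/ptime_chunks/ptime_head/ptime_behead.
Qed.

(** * The decision procedure *)

Definition row_key (mask : seq symbol) (r : row) : seq (seq symbol) :=
  [seq p.2 | p <- [seq p <- zip mask r.1 | p.1 == Bit true]].

Definition row_prob (r : row) : frac := head (0, 0, 1) r.2.

Definition row_terms (r : row) : seq frac :=
  [seq frac_mul (row_prob r) u | u <- behead r.2].

Definition fiber_sums (mask : seq symbol) (rows : seq row) (s : row) :=
  foldl (fun acc r => if row_key mask r == row_key mask s
                      then [seq frac_add p.1 p.2 | p <- zip acc (row_terms r)]
                      else acc)
    [seq (0, 0, 1) : frac | _ <- behead s.2] rows.

Definition argmax_mask (v : seq frac) : seq bool :=
  [seq all (fun r => frac_leq r q) v | q <- v].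

(** Total on words: malformed ones receive some answer too, as the time bound concerns every
    input. *)
Definition decide (w : seq symbol) : bool :=
  let cs := chunks Semicolon w in
  let mask := head [::] cs in
  let rows := [seq parse_row c | c <- behead cs] in
  all (fun s => argmax_mask (fiber_sums mask rows s)
                == argmax_mask (behead s.2)) rows.

Section DecideTime.
Context {X : Type} {dX : data X}.

Lemma ptime_row_key (mask : X -> seq symbol) (r : X -> row) :
  ptime mask -> ptime r -> ptime (fun x => row_key (mask x) (r x)).
Proof.
move=> pm pr; rewrite /row_key.
apply: (ptime_map (f := fun=> snd)); first by ptime_auto.
apply: (ptime_filter
  (p := fun (_ : X) (q : symbol * seq symbol) => q.1 == Bit true)).
  by apply: (ptime_symbol_pred (fun y => y == Bit true)); ptime_auto.
by apply: ptime_zip; ptime_auto.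
Qed.

Lemma ptime_row_terms (r : X -> row) :
  ptime r -> ptime (fun x => row_terms (r x)).
Proof.
move=> pr; rewrite /row_terms.
apply: (ptime_map (f := fun x u => frac_mul (row_prob (r x)) u)).
  apply: ptime_frac_mul; last by ptime_auto.
  by rewrite /row_prob; apply: ptime_head; ptime_auto.
by apply: ptime_behead; ptime_auto.
Qed.

Lemma ptime_argmax_mask (v : X -> seq frac) :
  ptime v -> ptime (fun x => argmax_mask (v x)).
Proof.
move=> pv; rewrite /argmax_mask.
apply: (ptime_map (f := fun x q => all (fun r => frac_leq r q) (v x))) => //.
apply: (ptime_all (p := fun (p : X * frac) r => frac_leq r p.2)).
  by apply: ptime_frac_leq; ptime_auto.
by ptime_auto.
Qed.

End DecideTime.

Lemma fracs_length_zip_add v t :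
  fracs_length [seq frac_add p.1 p.2 | p <- zip v t]
    <= fracs_length v + fracs_length t.
Proof.
elim: v t => [|q v IH] [|r t] //=; rewrite /fracs_length /= -!/(fracs_length _).
by have := frac_length_add q r; have := IH t; lia.
Qed.

(** The potential is [fracs_length]: it is polynomially equivalent to the encoded size, and each row
    adds at most the length of its terms. *)
Lemma ptime_fiber_sums {X : Type} {dX : data X} (mask : X -> seq symbol)
    (rows : X -> seq row) (s : X -> row) :
  ptime mask -> ptime rows -> ptime s ->
  ptime (fun x => fiber_sums (mask x) (rows x) (s x)).
Proof.
move=> pm prs ps; rewrite /fiber_sums.
apply: (ptime_foldl (Phi := fracs_length)
  (G := fun p : X * row => dsize (row_terms p.2))
  (f := fun x acc r => if row_key (mask x) r == row_key (mask x) (s x)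
    then [seq frac_add p.1 p.2 | p <- zip acc (row_terms r)] else acc)
  (b := fun x => [seq (0, 0, 1) : frac | _ <- behead (s x).2])) => //.
- apply: (@leq_pbound _ _ _ (fun v => 24 * fracs_length v + 1)).
    by move=> v; case/andP: (dsize_fracs v).
  apply: pboundD (pbound_const _ _).
  by apply: pboundM (pbound_const _ _) (pbound_id _).
- apply: leq_pbound (pbound_id _) => v; by case/andP: (dsize_fracs v).
- by apply: dsize_ptime; apply: ptime_row_terms; ptime_auto.
- move=> x acc r; case: ifP => _; last by lia.
  apply: leq_trans (fracs_length_zip_add _ _) _; rewrite leq_add2l.
  by case/andP: (dsize_fracs (row_terms r)).
- apply: ptime_if; last by ptime_auto.
    apply: ptime_eq_seq; try by apply: ptime_row_key; ptime_auto.
    by apply: ptime_eq_seq; [apply: ptime_eq_symbol|..]; ptime_auto.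
  apply: (ptime_map (f := fun=> fun p => frac_add p.1 p.2)).
    by apply: ptime_frac_add; ptime_auto.
  by apply: ptime_zip; [|apply: ptime_row_terms]; ptime_auto.
- apply: (ptime_map (f := fun _ _ => (0, 0, 1))); first by ptime_auto.
  by apply: ptime_behead; ptime_auto.
Qed.

Lemma ptime_decide : ptime decide.
Proof.
have pc : ptime (fun w => chunks Semicolon w) by apply/ptime_chunks/ptime_id.
have pm := ptime_head [::] pc.
have pr : ptime (fun w => [seq parse_row c | c <- behead (chunks Semicolon w)]).
  apply: (ptime_map (f := fun=> parse_row)).
    by apply: ptime_parse_row; ptime_auto.
  exact: ptime_behead.
rewrite /decide /=.
apply: (ptime_all (p := fun w s =>
  argmax_mask (fiber_sums (head [::] (chunks Semicolon w))
    [seq parse_row c | c <- behead (chunks Semicolon w)] s)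
    == argmax_mask (behead s.2))) => //.
apply: ptime_eq_seq; first by apply: ptime_eq_bool; ptime_auto.
  apply: ptime_argmax_mask; apply: ptime_fiber_sums; last by ptime_auto.
  - exact: (ptime_comp pm ptime_fst_proj).
  - exact: (ptime_comp pr ptime_fst_proj).
by apply: ptime_argmax_mask; apply: ptime_behead; ptime_auto.
Qed.

(** * From programs to machines *)

(** The input is first reversed onto stack 1; its code is then built from the last symbol backwards,
    starting with [Leaf]. *)
Definition encode_input : prog :=
  Seq (transfer 0 1) (Seq (Push 0 (inr false))
    (While 1 (Case 1 (fun a =>
       if a is Some (inl x) then
         push_after (Pop 1) (inr true :: cells (enc x))
       else Pop 1)))).

Lemma dsize_word (w : seq symbol) : dsize w = 18 * size w + 1.
Proof. by elim: w => // x w IH; rewrite dsize_cons dsize_symbol IH /=; lia. Qed.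

Lemma exec_encode_input w :
  exec_le encode_input (input_store w) (46 * size w + 4)
    (upd (fun=> [::]) 0 (cells (enc w))).
Proof.
have loop u : forall (v : seq symbol) (s : store),
    s 1 = [seq inl x | x <- u] -> s 0 = cells (enc v) ->
    exec_le (While 1 (Case 1 (fun a =>
       if a is Some (inl x) then
         push_after (Pop 1) (inr true :: cells (enc x))
       else Pop 1))) s (39 * size u).+1
      (upd (upd s 1 [::]) 0 (cells (enc (catrev u v)))).
  elim: u => [|x u IH] v s s1 s0.
    apply: (exec_le_weaken (exec_le_while0 _ s1)) => //= i.
    by rewrite /upd; case: eqP => [->//|_]; case: eqP => [->//|].
  (* 36 is two steps for each of 18 letters: the list node and the 17 letters of a symbol. *)
  apply: (@exec_le_weaken _ _ ((1 + 36).+1 + (39 * size u).+1).+1).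
  - apply: exec_le_whileS; first by rewrite s1.
      apply: exec_le_case; rewrite s1 [ohead _]/=.
      apply: (exec_le_weaken (exec_push_after _ (exec_le_pop _ _)) _ (frefl _)).
      by case: (x) => [[]|||||].
    apply: (IH (x :: v)); first by rewrite /upd /= s1.
    by rewrite -[RHS]/(cells (Node (enc x) (enc v))) cells_Node /upd /= s0.
  - by rewrite /=; lia.
  - by case=> [|[|i]].
apply: exec_le_weaken.
- apply: exec_le_seq; first exact: exec_transfer.
  apply: exec_le_seq; first exact: exec_le_push.
  apply: (loop (rev w) [::]); last by rewrite /upd.
  by rewrite /upd /= map_rev catrevE cats0.
- by rewrite /input_store /upd /= size_rev size_map; lia.
- by case=> [|[|i]]; rewrite /upd /= ?catrevE ?revK ?cats0.
Qed.

Lemma ptime_decidable (d : seq symbol -> bool) :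
  ptime d ->
  exists M : machine symbol,
    polynomial_time M /\ (forall w, accepts M w <-> d w).
Proof.
move=> [p [K [T [bT hp]]]].
have [c hc] : pbound size (fun w => 46 * size w + (T w + 5)).
  apply: pboundD; first by apply: pboundM (pbound_const _ _) (pbound_id _).
  apply: pboundD (pbound_const _ _).
  apply: (pbound_trans _ bT).
  apply: (@leq_pbound _ _ _ (fun w => 18 * size w + 1)).
    by move=> w; rewrite dsize_word.
  apply: pboundD (pbound_const _ _).
  by apply: pboundM (pbound_const _ _) (pbound_id _).
(* The final [Pop] removes the root of the coded boolean; the letter below it is the truth value
   that the machine reads. *)
apply: (@stack_program_decides _ (Seq encode_input (Seq p (Pop 0))) d c) => w.
have [|t le_t ex] := exec_le_seq (exec_encode_input w)
  (exec_le_seq (hp w (upd (fun=> [::]) 0 (cells (enc w))) erefl _)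
     (exec_le_pop 0 _)).
  by case.
eexists t, _; split; [|exact: ex|].
- by apply: (leq_trans le_t); apply: leq_trans (hc w); rewrite /=; lia.
- by rewrite /upd /=; case: (d w).
Qed.

(** * Correctness of the decision procedure *)

Import Order.TTheory GRing.Theory Num.Theory.

Section Chunks.
Variable sep : symbol.

Lemma chunks_cat a w :
  sep \notin a -> chunks sep (a ++ sep :: w) = a :: chunks sep w.
Proof.
elim: a => [|x a IH] /=; first by rewrite eqxx.
by rewrite in_cons negb_or eq_sym => /andP[/negbTE -> /IH ->].
Qed.

Lemma chunks_flatten (l : seq (seq symbol)) :
  all (fun a => sep \notin a) l ->
  chunks sep (flatten [seq rcons a sep | a <- l]) = l.
Proof.
by elim: l => //= a l IH /andP[na nl]; rewrite cat_rcons chunks_cat // IH.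
Qed.

End Chunks.

Lemma enc_natE n : enc_nat n = [seq Bit b | b <- bits n].
Proof. by rewrite /enc_nat /bits /mkseq -map_comp. Qed.

Lemma notin_enc_nat sep n : (forall b, Bit b != sep) -> sep \notin enc_nat n.
Proof.
move=> ne; rewrite enc_natE; apply/mapP => -[b _ e].
by have := ne b; rewrite e eqxx.
Qed.

Lemma bits_value_enc_nat n : bits_value (enc_nat n) = n.
Proof.
rewrite enc_natE; have [k] := ubnP n; elim: k n => // k IH n lt_n.
case: (posnP n) => [->//|n0]; rewrite bits_half //= IH; last by lia.
by rewrite -[RHS]odd_double_half; case: (odd n).
Qed.

Lemma enc_nat_inj : injective enc_nat.
Proof. exact: can_inj bits_value_enc_nat. Qed.

Lemma notin_enc_rat sep q :
  (forall b, Bit b != sep) -> sep != Minus -> sep != Slash ->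
  sep \notin enc_rat q.
Proof.
move=> ne nm ns.
rewrite /enc_rat !mem_cat in_cons !negb_or ns !notin_enc_nat //.
by case: ifP => // _; rewrite mem_seq1 nm.
Qed.

(** * Fractions as rational numbers *)

Local Open Scope ring_scope.

Definition frac_val (q : frac) : rat := (q.1.1%:R - q.1.2%:R) / q.2%:R.

(** Positivity of the denominator belongs to the invariant, since comparison multiplies by
    denominators. *)
Definition represents (q : frac) (x : rat) := (0 < q.2)%N /\ frac_val q = x.

Lemma represents_add q r x y :
  represents q x -> represents r y -> represents (frac_add q r) (x + y).
Proof.
move=> [q0 <-] [r0 <-]; split; first by rewrite /= muln_gt0 q0.
have {}q0 : q.2%:R != 0 :> rat by rewrite pnatr_eq0 -lt0n.
have {}r0 : r.2%:R != 0 :> rat by rewrite pnatr_eq0 -lt0n.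
by rewrite /frac_val /= !natrD !natrM; field; rewrite q0 r0.
Qed.

Lemma represents_mul q r x y :
  represents q x -> represents r y -> represents (frac_mul q r) (x * y).
Proof.
move=> [q0 <-] [r0 <-]; split; first by rewrite /= muln_gt0 q0.
have {}q0 : q.2%:R != 0 :> rat by rewrite pnatr_eq0 -lt0n.
have {}r0 : r.2%:R != 0 :> rat by rewrite pnatr_eq0 -lt0n.
by rewrite /frac_val /= !natrD !natrM; field; rewrite q0 r0.
Qed.

Lemma represents_leq q r x y :
  represents q x -> represents r y -> frac_leq q r = (x <= y).
Proof.
move=> [q0 <-] [r0 <-]; rewrite /frac_val /frac_leq.
rewrite ler_pdivrMr ?ltr0n // mulrAC ler_pdivlMr ?ltr0n //.
rewrite -(ler_nat rat) !natrD !natrM -subr_ge0 -[RHS]subr_ge0.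
by congr (0 <= _); ring.
Qed.

Lemma parse_frac_enc_rat q : represents (parse_frac (enc_rat q)) q.
Proof.
pose num := (if q < 0 then [:: Minus] else [::]) ++ enc_nat `|numq q|%N.
have e : chunks Slash (enc_rat q ++ [:: Slash]) = [:: num; enc_nat `|denq q|%N].
  rewrite /enc_rat catA -/num -catA /= chunks_cat; last first.
    by rewrite mem_cat negb_or notin_enc_nat // andbT; case: ifP.
  by rewrite (chunks_cat [::]) // notin_enc_nat.
rewrite /parse_frac e /= bits_value_enc_nat.
have d0 : (0 < `|denq q|)%N by rewrite absz_gt0 denq_eq0.
have hd : (`|denq q|%N)%:R = (denq q)%:~R :> rat.
  by rewrite natr_absz gtr0_norm.
have [q0|q0] := ltP q 0.
  have -> : num = Minus :: enc_nat `|numq q|%N by rewrite /num q0.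
  rewrite /= bits_value_enc_nat; split=> //.
  rewrite /frac_val /= sub0r hd natr_absz ltr0_norm ?numq_lt0 //.
  by rewrite rmorphN opprK divq_num_den.
have -> : num = enc_nat `|numq q|%N by rewrite /num ltNge q0.
(* A numeral consists of digits, and the default [Slash] covers the empty numeral of zero. *)
have -> : (head Slash (enc_nat `|numq q|%N) == Minus) = false.
  by rewrite enc_natE; case: (bits _).
rewrite bits_value_enc_nat; split=> //.
by rewrite /frac_val /= subr0 hd natr_absz ger0_norm ?numq_ge0 // divq_num_den.
Qed.

Lemma argmax_maskP (A : finType) (F : A -> frac) (f : A -> rat) :
  (forall a, represents (F a) (f a)) ->
  argmax_mask [seq F a | a <- enum A] = [seq a \in argmax f | a <- enum A].
Proof.
move=> hF; rewrite /argmax_mask -map_comp; apply: eq_map => a /=.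
rewrite inE all_map; apply/allP/forallP => [le b|le b _] /=.
  by rewrite -(represents_leq (hF b) (hF a)); apply: le; rewrite mem_enum.
by rewrite (represents_leq (hF b) (hF a)).
Qed.

(** * The procedure on encoded decision problems *)

Section DecideCorrect.
Variable D : stoch_problem.
Implicit Types (s : states D) (J : {set 'I_(ncoord D)}).

Definition coord_words s : seq (seq symbol) :=
  [seq enc_nat (enum_rank (s i)) | i <- enum 'I_(ncoord D)].

Definition table_words s : seq (seq symbol) :=
  enc_rat (prob s) :: [seq enc_rat (utility a s) | a <- enum (action D)].

Definition state_row s : row :=
  (coord_words s, [seq parse_frac c | c <- table_words s]).

Definition state_body s : seq symbol :=
  flatten [seq rcons c Comma | c <- coord_words s] ++
  Bar :: flatten [seq rcons c Comma | c <- table_words s].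

Definition mask_word J : seq symbol :=
  [seq Bit (i \in J) | i <- enum 'I_(ncoord D)].

(** This form exhibits mask and states alike as words closed by [Semicolon], ready for
    [chunks_flatten]. *)
Lemma explicit_encodingE J :
  explicit_encoding (CheckInstance J) =
  flatten [seq rcons c Semicolon |
            c <- mask_word J :: [seq state_body s | s <- enum (states D)]].
Proof.
rewrite /explicit_encoding /=; congr (_ ++ flatten _); rewrite -map_comp.
apply: eq_map => s /=; rewrite /enc_state /state_body /coord_words /table_words.
by rewrite -map_comp /= rcons_cat rcons_cons rcons_cat -map_comp.
Qed.

Lemma notin_flatten (sep sep' : symbol) (l : seq (seq symbol)) :
  sep != sep' -> all (fun a => sep \notin a) l ->
  sep \notin flatten [seq rcons c sep' | c <- l].
Proof.
move=> ne; elim: l => //= a l IH /andP[na /IH nl].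
by rewrite mem_cat mem_rcons in_cons !negb_or ne na.
Qed.

Lemma notin_coord_words sep s : (forall b, Bit b != sep) ->
  all (fun a => sep \notin a) (coord_words s).
Proof. by move=> ne; apply/allP => _ /mapP[i _ ->]; apply: notin_enc_nat. Qed.

Lemma notin_table_words sep s : (forall b, Bit b != sep) ->
  sep != Minus -> sep != Slash -> all (fun a => sep \notin a) (table_words s).
Proof.
move=> *; rewrite /= notin_enc_rat //=.
by apply/allP => _ /mapP[a _ ->]; apply: notin_enc_rat.
Qed.

Lemma parse_row_state s : parse_row (state_body s) = state_row s.
Proof.
rewrite /parse_row /state_body -catA cat_cons chunks_cat; last first.
  by rewrite notin_flatten // notin_coord_words.
rewrite chunks_cat; last by rewrite notin_flatten // notin_table_words.
by rewrite !chunks_flatten ?notin_coord_words ?notin_table_words.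
Qed.

Lemma chunks_explicit_encoding J :
  chunks Semicolon (explicit_encoding (CheckInstance J))
    = mask_word J :: [seq state_body s | s <- enum (states D)].
Proof.
rewrite explicit_encodingE chunks_flatten //=.
apply/andP; split; first by apply/mapP => -[].
apply/allP => _ /mapP[s _ ->]; rewrite /state_body mem_cat in_cons !negb_or.
by rewrite !notin_flatten ?notin_coord_words ?notin_table_words.
Qed.

(** Ranks and numerals are injective, so comparing words compares the coordinate values in [J]. *)
Lemma row_key_eq J s t :
  (row_key (mask_word J) (state_row s) == row_key (mask_word J) (state_row t))
    = (restriction J s == restriction J t).
Proof.
have key u : row_key (mask_word J) (state_row u)
    = [seq enc_nat (enum_rank (u i)) | i <- enum 'I_(ncoord D) & i \in J].
  rewrite /row_key zip_map filter_map -map_comp.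
  by congr map; apply: eq_filter => i /=; case: (i \in J).
rewrite !key; apply/eqP/eqP => [/eq_in_map e|e].
  apply/ffunP => i; rewrite !ffunE.
  have /e/enc_nat_inj/val_inj/enum_rank_inj // :
    val i \in [seq i <- enum 'I_(ncoord D) | i \in J].
  by rewrite mem_filter (valP i) mem_enum.
apply/eq_in_map => i; rewrite mem_filter => /andP[iJ _].
by have /ffunP/(_ (Sub i iJ)) := e; rewrite !ffunE /= => ->.
Qed.

Lemma utilitiesE s : behead (state_row s).2 =
  [seq parse_frac (enc_rat (utility a s)) | a <- enum (action D)].
Proof. by rewrite /= -map_comp. Qed.

(** The list is arbitrary, for an induction at its end, where [foldl] acts last. Fractions being
    unreduced, only the rationals they represent are determined. *)
Lemma fiber_sums_states J s (l : seq (states D)) :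
  exists2 F : action D -> frac,
    fiber_sums (mask_word J) [seq state_row t | t <- l] (state_row s)
      = [seq F a | a <- enum (action D)] &
    forall a, represents (F a)
      (\sum_(t <- l | restriction J t == restriction J s) prob t * utility a t).
Proof.
rewrite /fiber_sums utilitiesE -map_comp.
elim/last_ind: l => [|l t [F e hF]].
  exists (fun=> (0%N, 0%N, 1%N)) => // a; rewrite big_nil.
  by split=> //; rewrite /frac_val subrr mul0r.
rewrite map_rcons foldl_rcons e row_key_eq.
case: ifP => key; last first.
  by exists F => // a; rewrite -cats1 big_cat big_cons big_nil key /= addr0.
exists (fun a => frac_add (F a)
  (frac_mul (parse_frac (enc_rat (prob t)))
            (parse_frac (enc_rat (utility a t))))).
  by rewrite /row_terms utilitiesE -map_comp zip_map -map_comp.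
move=> a; rewrite -cats1 big_cat big_cons big_nil key /= addr0.
apply: represents_add => //.
by apply: represents_mul; apply: parse_frac_enc_rat.
Qed.

Lemma decide_correct J :
  decide (explicit_encoding (CheckInstance J)) <-> stoch_sufficient J.
Proof.
rewrite /decide chunks_explicit_encoding /= -map_comp.
rewrite (eq_map parse_row_state) all_map.
have maskE s :
  (argmax_mask (fiber_sums (mask_word J)
     [seq state_row t | t <- enum (states D)] (state_row s))
   == argmax_mask (behead (state_row s).2))
  = (opt_stoch (restriction J s) == opt s).
  have [F -> hF] := fiber_sums_states J s (enum (states D)).
  rewrite (argmax_maskP hF) utilitiesE.
  rewrite (argmax_maskP (f := fun a => utility a s)); last first.
    by move=> a; apply: parse_frac_enc_rat.
  rewrite /opt_stoch /opt.
  have -> : argmax (fun a => \sum_(t <- enum (states D) |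
      restriction J t == restriction J s) prob t * utility a t)
    = argmax (fun a => \sum_(t : states D |
      restriction J t == restriction J s) prob t * utility a t).
    apply/setP => a; rewrite !inE; apply: eq_forallb => b.
    by rewrite !big_enum_cond.
  (* The characteristic vector along [enum] determines a set of actions. *)
  apply/eqP/eqP => [/eq_in_map e|->//]; apply/setP => a.
  by rewrite e // mem_enum.
split=> [/allP h s|h].
  by apply/eqP; rewrite -maskE; apply: h; rewrite mem_enum.
by apply/allP => s _ /=; rewrite maskE h.
Qed.

End DecideCorrect.

Theorem mainTheorem1 :
  poly_time_decidable explicit_encoding
    (fun x : check_instance => stoch_sufficient (coords x)).
Proof.
have [M [poly acc]] := ptime_decidable ptime_decide.
exists M; split=> // -[D J] /=.
exact: iff_trans (acc _) (decide_correct J).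
Qed.
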